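(* Let $M,N\ge1$ be integers, let $A$ be a real $M\times N$ matrix, and let $$S=\mathrm{Bad}_A(M,N)=\Big\{\mathbf{x}\in\mathbb{R}^M:\ \inf_{\mathbf{q}\in\mathbb{Z}^N\setminus\{0\}}\|\mathbf{q}\|^{N/M}\,\mathrm{dist}(A\mathbf{q}-\mathbf{x},\mathbb{Z}^M)>0\Big\}.$$ For any hyperplane diffuse $K\subseteq\mathbb{R}^M$, and for any sequence of $C^1$ diffeomorphisms $(f_i)_{i=1}^\infty$ (each $f_i:U\to\mathbb{R}^M$ being a diffeomorphism onto its image, where $U\subseteq\mathbb{R}^M$ is an open set with $U\cap K\neq\varnothing$), the set $$K\cap\bigcap_{i=1}^\infty f_i^{-1}(S)$$ is winning on $K$ (for Schmidt's game). In particular, this set has positive Hausdorff dimension, and it has full dimension, i.e. the same Hausdorff dimension as $K\cap U$, if $K$ is the support of an Ahlfors regular measure. Thus, $\mathrm{Bad}_A(M,N)$ is strongly $C^1$ incompressible on $K$.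
   Context: $\|\cdot\|$ is the Euclidean norm and $\mathrm{dist}$ the associated distance. $B(\mathbf{x},\rho)$ is the ball of center $\mathbf{x}$ and radius $\rho$; $\mathcal{L}^{(\varepsilon)}$ is the $\varepsilon$-thickening of $\mathcal{L}$. Hyperplane diffuse: a closed set $K\subseteq\mathbb{R}^d$ is hyperplane diffuse if there exist $0<\beta<1$ and $\rho_K>0$ such that for all $0<\rho\le\rho_K$, all $\mathbf{x}\in K$ and every affine hyperplane $\mathcal{L}\subseteq\mathbb{R}^d$ there is a point $\mathbf{x}'\in K\cap\big(B(\mathbf{x},\rho)\setminus\mathcal{L}^{(\beta\rho)}\big)$. Ahlfors regular: a locally finite Borel measure $\mu$ on $\mathbb{R}^d$ is Ahlfors regular if for some $\delta$ there are positive constants $c_1,c_2,\rho_0$ with $c_1\rho^\delta\le\mu(B(\mathbf{x},\rho))\le c_2\rho^\delta$ for all $\mathbf{x}\in\mathrm{supp}\,\mu$ and $0<\rho<\rho_0$. Winning on $K$ (Schmidt's game): for $K\subseteq\mathbb{R}^d$ closed and $0<\alpha,\beta<1$, Bob and Alice alternately choose closed balls in $\mathbb{R}^d$ with centers in $K$, Bob moving first, such that $B_1\supseteq A_1\supseteq B_2\supseteq A_2\supseteq\cdots$, the radii satisfying $\rho(A_i)=\alpha\rho(B_i)$ and $\rho(B_{i+1})=\beta\rho(A_i)$ (the $B_i$ are Bob's moves, the $A_i$ Alice's). A set $T$ is $(\alpha,\beta)$-winning on $K$ if Alice has a strategy guaranteeing $\bigcap_iB_i\subseteq T$ however Bob plays;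 it is $\alpha$-winning on $K$ if it is $(\alpha,\beta)$-winning on $K$ for every $0<\beta<1$, and winning on $K$ if it is $\alpha$-winning on $K$ for some $\alpha$. Strongly $C^1$ incompressible on $K$: $S\subseteq\mathbb{R}^d$ has this property if for every open $U\subseteq\mathbb{R}^d$ with $U\cap K\ne\varnothing$ and every sequence of $C^1$ diffeomorphisms $f_i:U\to\mathbb{R}^d$ onto their images, the set $K\cap\bigcap_{i=1}^\infty f_i^{-1}(S)$ has the same Hausdorff dimension as $K\cap U$.
   Formalization: The set is shown winning on K itself if K ⊆ U; for general U its union with K \ U is shown winning, since otherwise Bob could start away from U. Strong C^1 incompressibility is stated for K the support of an Ahlfors regular measure. *)

(* Defs.v *)
From HB Require Import structures.
From mathcomp Require Import all_boot all_order all_algebra.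
From mathcomp Require Import all_classical all_reals all_analysis.

Set Implicit Arguments.
Unset Strict Implicit.
Unset Printing Implicit Defensive.

Import Order.TTheory GRing.Theory Num.Theory.
Import numFieldNormedType.Exports.

Local Open Scope classical_set_scope.
Local Open Scope ring_scope.

(** Points of R^d are column vectors.  The library norm [`|x|] on matrices is
    the sup norm; it is used here only through the topology it induces.  All
    metric notions below are defined from the Euclidean norm. *)

Definition enorm (R : realType) (d : nat) (x : 'cV[R]_d) : R :=
  Num.sqrt (\sum_(i < d) x i 0 ^+ 2).

(** Only used for nonempty [E] ([inf set0] is [0]). *)
Definition edist (R : realType) (d : nat) (x : 'cV[R]_d) (E : set 'cV[R]_d) : R :=
  inf [set enorm (x - y) | y in E].

Definition eball (R : realType) (d : nat) (x : 'cV[R]_d) (rho : R) : set 'cV[R]_d :=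
  [set y | enorm (y - x) <= rho].

Definition thickening (R : realType) (d : nat) (L : set 'cV[R]_d) (eps : R) :
    set 'cV[R]_d :=
  [set y | edist y L < eps].

Definition affine_hyperplane (R : realType) (d : nat) (L : set 'cV[R]_d) : Prop :=
  exists (a : 'cV[R]_d) (b : R),
    a != 0 /\ L = [set x | \sum_(i < d) a i 0 * x i 0 = b].

Definition hyperplane_diffuse (R : realType) (d : nat) (K : set 'cV[R]_d) : Prop :=
  closed K /\
  exists beta rhoK : R, [/\ 0 < beta, beta < 1, 0 < rhoK &
    forall (rho : R) (x : 'cV[R]_d) (L : set 'cV[R]_d),
      0 < rho -> rho <= rhoK -> K x -> affine_hyperplane L ->
      (K `&` (eball x rho `\` thickening L (beta * rho))) !=set0].

(** ** Ahlfors regular measures *)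

Definition Rd_borel (R : realType) (d : nat) :=
  g_sigma_algebraType (@open 'cV[R]_d).

Definition locally_finite (R : realType) (d : nat)
    (mu : {measure set (Rd_borel R d) -> \bar R}) : Prop :=
  forall x : 'cV[R]_d, exists V : set 'cV[R]_d,
    [/\ open V, V x & (mu V < +oo)%E].

Definition msupport (R : realType) (d : nat)
    (mu : {measure set (Rd_borel R d) -> \bar R}) : set 'cV[R]_d :=
  [set x | forall V : set 'cV[R]_d, open V -> V x -> (0 < mu V)%E].

Definition ahlfors_regular (R : realType) (d : nat)
    (mu : {measure set (Rd_borel R d) -> \bar R}) : Prop :=
  locally_finite mu /\
  exists delta c1 c2 rho0 : R, [/\ 0 < c1, 0 < c2, 0 < rho0 &
    forall (x : 'cV[R]_d) (rho : R),
      msupport mu x -> 0 < rho -> rho < rho0 ->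
      ((c1 * rho `^ delta)%:E <= mu (eball x rho))%E /\
      (mu (eball x rho) <= (c2 * rho `^ delta)%:E)%E].

Definition ahlfors_regular_support (R : realType) (d : nat) (K : set 'cV[R]_d) :
    Prop :=
  exists mu : {measure set (Rd_borel R d) -> \bar R},
    ahlfors_regular mu /\ msupport mu = K.

(** ** Hausdorff dimension *)

(** [-oo] on the empty set. *)
Definition ediam (R : realType) (d : nat) (E : set 'cV[R]_d) : \bar R :=
  ereal_sup [set (enorm (x - y))%:E | x in E & y in E].

Definition hausdorff_gauge (R : realType) (d : nat) (s : R) (E : set 'cV[R]_d) :
    \bar R :=
  if E == set0 then 0%E else poweR (ediam E) s.

Definition hausdorff_content (R : realType) (d : nat) (s delta : R)
    (E : set 'cV[R]_d) : \bar R :=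
  ereal_inf
    [set (\sum_(0 <= i <oo) hausdorff_gauge s (F i))%E
      | F in [set F : nat -> set 'cV[R]_d |
              E `<=` \bigcup_i F i /\
              forall i, (ediam (F i) <= delta%:E)%E]].

Definition hausdorff_measure (R : realType) (d : nat) (s : R)
    (E : set 'cV[R]_d) : \bar R :=
  ereal_sup [set hausdorff_content s delta E | delta in [set delta : R | 0 < delta]].

Definition hausdorff_dim (R : realType) (d : nat) (E : set 'cV[R]_d) : \bar R :=
  ereal_inf [set s%:E | s in [set s : R | 0 <= s /\ hausdorff_measure s E = 0%E]].

(** ** Schmidt's game on [K] *)

(** A ball is recorded as the pair of its center and its radius. *)
Definition gball (R : realType) (d : nat) : Type := ('cV[R]_d * R)%type.

Definition gball_set (R : realType) (d : nat) (b : gball R d) : set 'cV[R]_d :=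
  eball b.1 b.2.

(** A strategy for Alice gives her next ball from the (nonempty, chronological)
    list of the balls chosen so far by Bob; her own previous balls are
    determined by these. *)
Definition strategy (R : realType) (d : nat) : Type := seq (gball R d) -> gball R d.

Definition alice_ball (R : realType) (d : nat) (sigma : strategy R d)
    (B : nat -> gball R d) (n : nat) : gball R d :=
  sigma (mkseq B n.+1).

Definition bob_legal_upto (R : realType) (d : nat) (K : set 'cV[R]_d) (beta : R)
    (sigma : strategy R d) (B : nat -> gball R d) (n : nat) : Prop :=
  [/\ K (B 0%N).1, 0 < (B 0%N).2 &
    forall k, (k < n)%N ->
      let A := alice_ball sigma B k in
      [/\ K (B k.+1).1, (B k.+1).2 = beta * A.2 &
          gball_set (B k.+1) `<=` gball_set A]].

Definition alice_legal_at (R : realType) (d : nat) (K : set 'cV[R]_d) (alpha : R)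
    (sigma : strategy R d) (B : nat -> gball R d) (n : nat) : Prop :=
  let A := alice_ball sigma B n in
  [/\ K A.1, A.2 = alpha * (B n).2 & gball_set A `<=` gball_set (B n)].

(** The first condition requires Alice to answer every legal finite sequence of
    moves of Bob by a legal move: she cannot win by making an illegal move which
    leaves Bob without any legal continuation. *)
Definition ab_winning_on (R : realType) (d : nat) (K : set 'cV[R]_d)
    (alpha beta : R) (T : set 'cV[R]_d) : Prop :=
  exists sigma : strategy R d, forall B : nat -> gball R d,
    (forall n, bob_legal_upto K beta sigma B n -> alice_legal_at K alpha sigma B n) /\
    ((forall n, bob_legal_upto K beta sigma B n) ->
       \bigcap_n gball_set (B n) `<=` T).

Definition alpha_winning_on (R : realType) (d : nat) (K : set 'cV[R]_d)
    (alpha : R) (T : set 'cV[R]_d) : Prop :=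
  forall beta : R, 0 < beta -> beta < 1 -> ab_winning_on K alpha beta T.

Definition winning_on (R : realType) (d : nat) (K T : set 'cV[R]_d) : Prop :=
  exists alpha : R, [/\ 0 < alpha, alpha < 1 & alpha_winning_on K alpha T].

(** ** [C^1] diffeomorphisms and strong [C^1] incompressibility *)

(** Meaningful for open [U]: only the values of [f] on [U] matter. *)
Definition C1_on (R : realType) (d : nat) (U : set 'cV[R]_d)
    (f : 'cV[R]_d -> 'cV[R]_d) : Prop :=
  forall x, U x -> differentiable f x /\
    forall v : 'cV[R]_d, {for x, continuous (fun y => 'd f y v)}.

(** A map [U -> R^d] is represented by a total function, whose values outside
    [U] are irrelevant. *)
Definition C1_diffeo_on (R : realType) (d : nat) (U : set 'cV[R]_d)
    (f : 'cV[R]_d -> 'cV[R]_d) : Prop :=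
  [/\ C1_on U f, open (f @` U) &
    exists g : 'cV[R]_d -> 'cV[R]_d,
      C1_on (f @` U) g /\ forall x, U x -> g (f x) = x].

(** [K] intersected with all the preimages [f_i^{-1}(S)], where the domain of
    [f_i] is [U]. *)
Definition preimages_on (R : realType) (d : nat) (K U S : set 'cV[R]_d)
    (f : nat -> 'cV[R]_d -> 'cV[R]_d) : set 'cV[R]_d :=
  K `&` \bigcap_i (U `&` f i @^-1` S).

Definition strongly_C1_incompressible_on (R : realType) (d : nat)
    (K S : set 'cV[R]_d) : Prop :=
  forall (U : set 'cV[R]_d) (f : nat -> 'cV[R]_d -> 'cV[R]_d),
    open U -> U `&` K !=set0 -> (forall i, C1_diffeo_on U (f i)) ->
    hausdorff_dim (preimages_on K U S f) = hausdorff_dim (K `&` U).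

(** ** Badly approximable vectors *)

Definition int_points (R : realType) (d : nat) : set 'cV[R]_d :=
  [set map_mx intr p | p in [set: 'cV[int]_d]].

Definition Bad (R : realType) (M N : nat) (A : 'M[R]_(M, N)) : set 'cV[R]_M :=
  [set x | 0 < inf [set enorm (map_mx intr q : 'cV[R]_N) `^ (N%:R / M%:R) *
                        edist (A *m map_mx intr q - x) (@int_points R M)
                     | q in [set q : 'cV[int]_N | q != 0]]].

(* Main.v *)
Require Import Defs.
From HB Require Import structures.
From mathcomp Require Import all_boot all_order all_algebra.
From mathcomp Require Import all_classical all_reals all_analysis.
From mathcomp Require Import ring lra zify.

Set Implicit Arguments.
Unset Strict Implicit.
Unset Printing Implicit Defensive.

Import Order.TTheory GRing.Theory Num.Theory.
Import numFieldNormedType.Exports.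

Local Open Scope classical_set_scope.
Local Open Scope ring_scope.

(** Let [q] be a nonzero integer vector.  Pairing [A *m q - x - p] with an integer
    vector [y] such that [A^T *m y] is close to an integer vector turns it into
    an integer minus [dot y x], up to a small error.  This transference shows
    that [x] is badly approximable as soon as [dot y x] stays at distance at
    least some [e > 0] from the integers for all [y] in a sequence of best
    approximations to the transpose of [A], which has at most one vector in each
    dyadic range ([bad_of_sequence]).  So Alice has to keep away from the
    hyperplanes [dot y x = n]; for a given [y] they are parallel, at distance
    the inverse of [enorm y], and the allowed width may be any fixed proportion
    of this distance.

    For the preimage by a C^1 diffeomorphism [f] the hyperplanes become
    hypersurfaces, but in a small ball [f] is close to an invertible linear map
    ([diffeo_strict]).  Given finitely many such hypersurfaces with weights,
    those whose normals are almost parallel to a common vector make up a fixed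
    proportion, and, [K] being hyperplane diffuse, Alice can move far away from
    at least half of these ([one_move]).  As Bob may shrink the balls by a large
    factor between two moves of Alice, many hypersurfaces are waiting at each
    time.  A potential, the sum of a power of the scales of the pending
    hypersurfaces, shows that none of them waits for too long
    ([escapes_positional]).  The ratio of Alice depends on [K] only: it is the
    same for all maps, and a countable intersection is obtained by devoting to
    each map an arithmetic progression of moves ([alpha_winning_bigcap]).

    For the dimension, fix a winning strategy of Alice and let Bob start in [U]
    and choose at each turn among [N] separated balls centered in [K].  The
    resulting Cantor set lies in the intersection and has dimension at least
    [s] if [N * (al * be) `^ s] is at least [1] ([winning_dim_ge]): an efficient
    cover would give countably many cylinders of small total mass, and these
    never contain all words ([avoid_words]).  Diffuseness alone gives [N = 2], hence
    positive dimension.  If [K] supports an Ahlfors regular measure of exponent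
    [delta], a comparison of measures gives [N] at least a multiple of
    [be `^ (- delta)] ([ahlfors_branch]), so that every [s < delta] is reached
    for small [be], while [K] itself has dimension at most [delta]
    ([ahlfors_dim_le]). *)

(* [edist] is also the name of the extended distance of pseudometric spaces *)
Local Notation edist := Defs.edist.

(** * Euclidean geometry of column vectors *)

Section Euclid.
Variables (R : realType) (d : nat).
Implicit Types x y z u v : 'cV[R]_d.

Definition dot u v : R := \sum_(i < d) u i 0 * v i 0.

Lemma dotC u v : dot u v = dot v u.
Proof. by apply: eq_bigr => i _; rewrite mulrC. Qed.

Lemma dotDr u v w : dot u (v + w) = dot u v + dot u w.
Proof. by rewrite -big_split; apply: eq_bigr => i _; rewrite mxE mulrDr. Qed.

Lemma dotZr a u v : dot u (a *: v) = a * dot u v.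
Proof. by rewrite mulr_sumr; apply: eq_bigr => i _; rewrite mxE mulrCA. Qed.

Lemma dotNr u v : dot u (- v) = - dot u v.
Proof. by rewrite -scaleN1r dotZr mulN1r. Qed.

Lemma dotBr u v w : dot u (v - w) = dot u v - dot u w.
Proof. by rewrite dotDr dotNr. Qed.

Lemma dotDl u v w : dot (u + v) w = dot u w + dot v w.
Proof. by rewrite !(dotC _ w) dotDr. Qed.

Lemma dotZl a u v : dot (a *: u) v = a * dot u v.
Proof. by rewrite !(dotC _ v) dotZr. Qed.

Lemma dotBl u v w : dot (u - v) w = dot u w - dot v w.
Proof. by rewrite !(dotC _ w) dotBr. Qed.

Lemma dot_ge0 u : 0 <= dot u u.
Proof. by apply: sumr_ge0 => i _; rewrite -expr2 sqr_ge0. Qed.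

Lemma enormE u : enorm u = Num.sqrt (dot u u).
Proof. by congr Num.sqrt; apply: eq_bigr => i _; rewrite expr2. Qed.

Lemma enorm_ge0 u : 0 <= enorm u.
Proof. exact: sqrtr_ge0. Qed.

Lemma enorm_sqr u : enorm u ^+ 2 = dot u u.
Proof. by rewrite enormE sqr_sqrtr // dot_ge0. Qed.

Lemma enormZ a u : enorm (a *: u) = `|a| * enorm u.
Proof.
rewrite !enormE dotZl dotZr mulrA -expr2 sqrtrM ?sqr_ge0 //.
by rewrite sqrtr_sqr.
Qed.

Lemma enormN u : enorm (- u) = enorm u.
Proof. by rewrite -scaleN1r enormZ normrN1 mul1r. Qed.

Lemma enormB u v : enorm (u - v) = enorm (v - u).
Proof. by rewrite -enormN opprB. Qed.

Lemma enorm0 : enorm (0 : 'cV[R]_d) = 0.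
Proof. by rewrite -(scale0r (0 : 'cV[R]_d)) enormZ normr0 mul0r. Qed.

Lemma enorm_gt0 u : (0 < enorm u) = (u != 0).
Proof.
apply/idP/idP => [|u0]; first by apply: contraTneq => ->; rewrite enorm0 ltxx.
rewrite enormE sqrtr_gt0 lt_neqAle dot_ge0 andbT eq_sym.
apply: contra u0 => /eqP e; apply/eqP/matrixP => i j; rewrite ord1 mxE.
have := @psumr_eq0P _ _ predT (fun i => u i 0 * u i 0) _ e.
by move=> /(_ (fun i _ => ltac:(by rewrite -expr2 sqr_ge0)) i isT)/eqP;
   rewrite mulf_eq0 orbb => /eqP.
Qed.

Lemma dot_le u v : `|dot u v| <= enorm u * enorm v.
Proof.
have [->|v0] := eqVneq v 0.
  by rewrite -(scale0r (0 : 'cV[R]_d)) dotZr mul0r normr0 mulr_ge0 ?enorm_ge0.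
have vv : 0 < dot v v by rewrite -enorm_sqr exprn_gt0 // enorm_gt0.
rewrite -(@ler_pXn2r _ 2) ?nnegrE ?mulr_ge0 ?enorm_ge0 //.
rewrite exprMn !enorm_sqr real_normK ?num_real //.
(* the component of [u] orthogonal to [v], up to the factor [dot v v] *)
have := dot_ge0 (dot v v *: u - dot u v *: v).
rewrite dotBl !dotBr !dotZl !dotZr (dotC v u).
set a := dot u u; set b := dot u v; set c := dot v v => h.
have : 0 <= c * (a * c - b ^+ 2).
  by apply: le_trans h _; rewrite le_eqVlt; apply/orP; left; apply/eqP; ring.
by rewrite pmulr_rge0 // subr_ge0.
Qed.

Lemma enormD u v : enorm (u + v) <= enorm u + enorm v.
Proof.
rewrite -(@ler_pXn2r _ 2) ?nnegrE ?addr_ge0 ?enorm_ge0 //.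
rewrite enorm_sqr dotDl !dotDr -!enorm_sqr (dotC v u).
have := dot_le u v; have := ler_norm (dot u v); nra.
Qed.

Lemma enorm_triangle v u w : enorm (u - w) <= enorm (u - v) + enorm (v - w).
Proof. by rewrite -(subrKA v) enormD. Qed.

Lemma coord_le_enorm u i : `|u i 0| <= enorm u.
Proof.
rewrite -(@ler_pXn2r _ 2) ?nnegrE ?enorm_ge0 // enorm_sqr real_normK ?num_real //.
rewrite /dot (bigD1 i) //= expr2 lerDl; apply: sumr_ge0 => k _.
by rewrite -expr2 sqr_ge0.
Qed.

Lemma enorm_le_coord u (c : R) : 0 <= c -> (forall i, `|u i 0| <= c) ->
  enorm u <= d%:R * c.
Proof.
move=> c0 uc; rewrite -(@ler_pXn2r _ 2) ?nnegrE ?enorm_ge0 ?mulr_ge0 //.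
rewrite enorm_sqr exprMn.
apply: (@le_trans _ _ (\sum_(i < d) c ^+ 2)).
  by apply: ler_sum => i _; rewrite -expr2 -real_normK ?num_real // ler_pXn2r ?nnegrE.
rewrite sumr_const card_ord -[leLHS]mulr_natl ler_wpM2r ?sqr_ge0 //.
by rewrite -natrX ler_nat; case: (d) => // k; rewrite expnS leq_pmulr.
Qed.

Lemma mxnorm_le_enorm u : `|u| <= enorm u.
Proof.
rewrite [leLHS]/Num.Def.normr/= mx_normrE; apply: bigmax_le; first exact: enorm_ge0.
by move=> [i j] _; rewrite ord1 coord_le_enorm.
Qed.

Lemma coord_le_mxnorm u i : `|u i 0| <= `|u|.
Proof.
rewrite [leRHS]/Num.Def.normr/= mx_normrE.
exact: (le_bigmax _ (fun ij : 'I_d * 'I_1 => `|u ij.1 ij.2|) (i, 0)).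
Qed.

Lemma enorm_le_mxnorm u : enorm u <= d%:R * `|u|.
Proof. by apply: enorm_le_coord => // i; exact: coord_le_mxnorm. Qed.

(** The topology comes from the sup norm, which is equivalent to the Euclidean
    norm. *)
Lemma nbhs_eball x (U : set 'cV[R]_d) :
  nbhs x U <-> exists2 rho : R, 0 < rho & eball x rho `<=` U.
Proof.
split=> [/nbhs_ballP[e /= e0 eU]|[rho r0 rU]].
  exists (e / 2); first by rewrite divr_gt0.
  move=> y /= yx; apply: eU; rewrite -ball_normE /= (le_lt_trans (mxnorm_le_enorm _)) //.
  by rewrite enormB (le_lt_trans yx) // ltr_pdivrMr // ltr_pMr // ltr1n.
have d0 : 0 < d%:R + 1 :> R by rewrite ltr_wpDl.
apply/nbhs_ballP; exists (rho / (d%:R + 1)); first by rewrite /= divr_gt0.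
move=> y; rewrite -ball_normE /= => yx; apply: rU; rewrite /eball /=.
rewrite enormB (le_trans (enorm_le_mxnorm _)) //.
rewrite (@le_trans _ _ (d%:R * (rho / (d%:R + 1)))) ?ler_wpM2l ?(ltW yx) //.
by rewrite mulrCA ger_pMr // ler_pdivrMr // mul1r lerDl.
Qed.

Lemma open_eball x (U : set 'cV[R]_d) :
  open U -> U x -> exists2 rho : R, 0 < rho & eball x rho `<=` U.
Proof. by move=> oU Ux; apply/nbhs_eball; exact: open_nbhs_nbhs. Qed.

Lemma closed_enorm x (K : set 'cV[R]_d) : closed K ->
  (forall rho : R, 0 < rho -> exists2 y, K y & enorm (y - x) <= rho) -> K x.
Proof.
move=> cK h; apply: cK => U /nbhs_eball[rho r0 rU].
by have [y Ky yx] := h _ r0; exists y; split => //; apply: rU.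
Qed.

Lemma continuous_enormB x : continuous (fun y => enorm (y - x)).
Proof.
move=> y; apply/(@cvgrPdist_le _ _ _ (nbhs y)) => e e0; apply/nbhs_eball; exists e => // z /= zy.
rewrite ler_norml; apply/andP; split.
  by have := enorm_triangle y z x; move: zy; rewrite /eball /=; lra.
by have := enorm_triangle z y x; move: zy; rewrite /eball /= (enormB y z); lra.
Qed.

Lemma closed_eball x (r : R) : closed (eball x r).
Proof.
have := @preimage_closed _ _ (fun y => enorm (y - x)) [set t | t <= r].
apply; last exact: closed_le.
by move=> y _; exact: continuous_enormB.
Qed.

Lemma open_enorm_lt x (r : R) : open [set y | enorm (y - x) < r].
Proof.
have := @open_comp _ _ (fun y => enorm (y - x)) [set t | t < r].
apply; last exact: open_lt.
by move=> y _; exact: continuous_enormB.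
Qed.

Lemma eball_center x (r : R) : 0 <= r -> eball x r x.
Proof. by move=> r0; rewrite /eball /= subrr enorm0. Qed.

Lemma eball_sub x y (r s : R) : enorm (y - x) + s <= r -> eball y s `<=` eball x r.
Proof.
move=> h z; rewrite /eball /= => zy; rewrite (le_trans (enorm_triangle y _ _)) //.
by rewrite (le_trans _ h) // addrC lerD2l.
Qed.

End Euclid.

Lemma enorm_mulmx_le (R : realType) (m n : nat) (A : 'M[R]_(m, n)) :
  exists2 C : R, 0 < C & forall v, enorm (A *m v) <= C * enorm v.
Proof.
pose S := \sum_i \sum_j `|A i j|.
have S0 : 0 <= S by apply: sumr_ge0 => i _; apply: sumr_ge0.
exists (m%:R * S + 1); first by rewrite ltr_wpDl // mulr_ge0.
move=> v; apply: (@le_trans _ _ (m%:R * (S * enorm v))); last first.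
  by rewrite mulrA ler_wpM2r ?enorm_ge0 // lerDl.
apply: enorm_le_coord => [|i]; first by rewrite mulr_ge0 ?enorm_ge0.
rewrite mxE (le_trans (ler_norm_sum _ _ _)) //.
apply: (@le_trans _ _ ((\sum_j `|A i j|) * enorm v)).
  by rewrite mulr_suml; apply: ler_sum => j _; rewrite normrM ler_wpM2l ?coord_le_enorm.
rewrite ler_wpM2r ?enorm_ge0 // /S (bigD1 i) //= lerDl.
by apply: sumr_ge0 => k _; apply: sumr_ge0.
Qed.

Lemma dot_mulmx (R : realType) (m n : nat) (A : 'M[R]_(m, n)) u v :
  dot u (A *m v) = dot (A^T *m u) v.
Proof.
rewrite /dot; under eq_bigr do rewrite mxE mulr_sumr.
rewrite exchange_big /=; apply: eq_bigr => j _; rewrite mxE mulr_suml.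
by apply: eq_bigr => i _; rewrite mxE mulrA (mulrC (A i j)).
Qed.

(** The form in which diffuseness is used: the point avoiding the hyperplane
    through [x] orthogonal to [a] is far from [x] in the direction [a], since
    its orthogonal projection belongs to the hyperplane. *)
Lemma diffuse_direction (R : realType) (d : nat) (K : set 'cV[R]_d) :
  hyperplane_diffuse K ->
  exists be rK : R, [/\ 0 < be, be < 1, 0 < rK &
    forall (rho : R) (x a : 'cV[R]_d), 0 < rho -> rho <= rK -> K x -> a != 0 ->
    exists x', [/\ K x', enorm (x' - x) <= rho &
                   be * rho * enorm a <= `|dot a (x' - x)|]].
Proof.
move=> [_ [be [rK [be0 be1 rK0 H]]]]; exists be, rK; split=> // rho x a r0 rrK Kx a0.
have aa : 0 < dot a a by rewrite -enorm_sqr exprn_gt0 // enorm_gt0.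
pose L := [set y : 'cV[R]_d | \sum_(i < d) a i 0 * y i 0 = dot a x].
have [] := H rho x L r0 rrK Kx; first by exists a, (dot a x).
move=> x' [Kx' [xx' nL]]; exists x'; split=> //.
(* the orthogonal projection of [x'] to [L] is [x' - t *: a] *)
pose t := dot a (x' - x) / dot a a.
have Lp : L (x' - t *: a).
  rewrite /L /= -/(dot a (x' - t *: a)) !(dotBr, dotZr) /t divfK ?gt_eqF //.
  by rewrite dotBr opprB addrC subrK.
have : be * rho <= enorm (x' - (x' - t *: a)).
  rewrite leNgt; apply/negP => lt; apply: nL; rewrite /thickening /=.
  apply: le_lt_trans lt; apply: ge_inf; last by exists (x' - t *: a).
  by exists 0 => _ [y _ <-]; exact: enorm_ge0.
rewrite opprB addrC subrK enormZ => h.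
rewrite (le_trans (ler_wpM2r (enorm_ge0 a) h)) // -mulrA -expr2 enorm_sqr.
by rewrite /t normrM normfV (gtr0_norm aa) divfK // gt_eqF.
Qed.

(** * A sequence of integer vectors detecting bad approximability *)

Section BestApproximation.
Variables (R : realType) (M N : nat).
Hypotheses (hM : (1 <= M)%N) (hN : (1 <= N)%N).
Variable A : 'M[R]_(M, N).

Let toR (d : nat) (v : 'cV[int]_d) : 'cV[R]_d := map_mx intr v.

Let err (y : 'cV[int]_M) : R := edist (A^T *m toR y) (@int_points R N).

Lemma edist_le d (x p : 'cV[R]_d) (E : set 'cV[R]_d) : E p -> edist x E <= enorm (x - p).
Proof.
move=> Ep; apply: ge_inf; last by exists p.
by exists 0 => _ [y _ <-]; exact: enorm_ge0.
Qed.

Lemma edist_lt d (x : 'cV[R]_d) (E : set 'cV[R]_d) (t : R) : E !=set0 ->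
  edist x E < t -> exists2 p, E p & enorm (x - p) < t.
Proof.
move=> [p0 Ep0] lt.
have [|_ [p Ep <-] pt] := @inf_lt _ [set enorm (x - y) | y in E] t _ lt.
  by exists (enorm (x - p0)), p0.
by exists p.
Qed.

Lemma le_edist d (x : 'cV[R]_d) (E : set 'cV[R]_d) (t : R) : E !=set0 ->
  (forall p, E p -> t <= enorm (x - p)) -> t <= edist x E.
Proof.
move=> [p0 Ep0] h; apply: lb_le_inf; first by exists (enorm (x - p0)), p0.
by move=> _ [p Ep <-]; exact: h.
Qed.

Lemma int_points0 d : @int_points R d !=set0.
Proof. by exists (map_mx intr 0), 0. Qed.

(** Dirichlet's theorem: two of the [H.+1 ^ M] integer vectors in a cube have
    images by the transpose of [A] in the same of the [G ^ N] boxes modulo 1;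
    their difference is the approximation. *)
Lemma dirichlet (H G : nat) : (0 < G)%N -> (G ^ N < H.+1 ^ M)%N ->
  exists y : 'cV[int]_M,
    [/\ y != 0, forall i, (`|y i 0%R| <= H)%N & err y <= N%:R / G%:R].
Proof.
move=> G0 GH.
have GR : 0 < G%:R :> R by rewrite ltr0n.
pose vec (f : {ffun 'I_M -> 'I_H.+1}) : 'cV[int]_M := \col_i (f i)%:Z.
pose a f i : R := (A^T *m toR (vec f)) i 0.
pose fr f i : R := a f i - (Num.floor (a f i))%:~R.
have fr0 f i : 0 <= fr f i by rewrite subr_ge0 floor_le.
have fr1 f i : fr f i < 1.
  by have := floorD1_gt (a f i); rewrite intrD /fr ltrBlDl.
have cell f i : (Num.truncn (G%:R * fr f i) < G)%N.
  by rewrite truncn_lt_nat ?mulr_ge0 // gtr_pMr.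
pose phi f : {ffun 'I_N -> 'I_G} := [ffun i => Ordinal (cell f i)].
have : ~~ injectiveb phi.
  apply/negP => /injectiveP /leq_card; rewrite !card_ffun !card_ord.
  by rewrite leqNgt GH.
case/injectivePn => f [g fg phifg]; exists (vec f - vec g); split.
- apply: contra_neq fg => e; apply/ffunP => i; apply/val_inj.
  by have /matrixP/(_ i 0) := e; rewrite !mxE => /eqP; rewrite subr_eq0 => /eqP[].
- move=> i; rewrite !mxE; move: (ltn_ord (f i)) (ltn_ord (g i)).
  by move: (nat_of_ord (f i)) (nat_of_ord (g i)) => p q; lia.
pose p : 'cV[int]_N := \col_i (Num.floor (a f i) - Num.floor (a g i)).
apply: le_trans (edist_le (p := toR p) _ _) _; first by exists p.
apply: enorm_le_coord => [|i]; first by rewrite invr_ge0 ltW.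
have -> : (A^T *m toR (vec f - vec g) - toR p) i 0 = fr f i - fr g i.
  by rewrite /toR map_mxB mulmxBr !mxE rmorphB /fr /a !mxE /toR; ring.
have tf := truncn_itv (mulr_ge0 (ltW GR) (fr0 f i)).
have tg := truncn_itv (mulr_ge0 (ltW GR) (fr0 g i)).
have /ffunP/(_ i) := phifg; rewrite !ffunE => /(congr1 val) /= e.
move: tf tg; rewrite e => /andP[t1 t2] /andP[t3 t4].
rewrite -[leRHS]mul1r ler_pdivlMr // -{1}(gtr0_norm GR) -normrM.
move: t1 t2 t3 t4; rewrite -natr1 => t1 t2 t3 t4.
by rewrite ler_norml; apply/andP; split; lra.
Qed.

Lemma best_at (H : nat) : (0 < H)%N ->
  exists z : 'cV[int]_M, [/\ z != 0, forall i, (`|z i 0%R| <= H)%N &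
    forall y : 'cV[int]_M, y != 0 -> (forall i, (`|y i 0%R| <= H)%N) -> err z <= err y].
Proof.
move=> H0.
pose vec (f : {ffun 'I_M -> 'I_(H + H).+1}) : 'cV[int]_M := \col_i ((f i)%:Z - H%:Z).
have vecK (y : 'cV[int]_M) : (forall i, (`|y i 0%R| <= H)%N) -> exists f, vec f = y.
  move=> yH; have lt i : (`|(y i 0 + H%:Z)%R| < (H + H).+1)%N.
    by move: (yH i); move: (y i 0) => p; lia.
  exists [ffun i => Ordinal (lt i)]; apply/matrixP => i j; rewrite !mxE ffunE /= ord1.
  by move: (yH i); move: (y i 0) => p; lia.
have [f0 Hf0] := vecK (const_mx 1) (fun i => ltac:(by rewrite mxE)).
have f0n : vec f0 != 0.
  rewrite Hf0; apply/eqP => /matrixP/(_ (Ordinal hM) 0); rewrite !mxE.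
  by move/eqP; rewrite oner_eq0.
have [f fn0 fmin] :=
  @arg_minP _ _ _ f0 (fun f => vec f != 0) (fun f => err (vec f)) f0n.
exists (vec f); split=> // [i|y yn0 /vecK[g gy]].
  by rewrite mxE; move: (ltn_ord (f i)); move: (nat_of_ord (f i)) => p; lia.
by rewrite -gy; apply: fmin; rewrite gy.
Qed.

(** The best approximation at height [2 ^ j.+1] is taken to be the one at height
    [2 ^ j] whenever that one is still optimal: a change of value then forces a
    vector of size comparable to [2 ^ j.+1], and there is at most one new
    vector in each dyadic range. *)
Lemma best_sequence : exists z : nat -> 'cV[int]_M, forall j,
  [/\ z j != 0, forall i, (`|z j i 0%R| <= 2 ^ j)%N,
      forall y : 'cV[int]_M, y != 0 -> (forall i, (`|y i 0%R| <= 2 ^ j)%N) -> err (z j) <= err y &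
      z j.+1 = z j \/ exists i, (2 ^ j < `|z j.+1 i 0%R|)%N].
Proof.
have /choice[m Hm] : forall j : nat, exists z : 'cV[int]_M,
   [/\ z != 0, forall i, (`|z i 0%R| <= 2 ^ j)%N &
    forall y : 'cV[int]_M, y != 0 -> (forall i, (`|y i 0%R| <= 2 ^ j)%N) -> err z <= err y].
  by move=> j; apply: best_at; rewrite expn_gt0.
pose z := fix z j := if j is k.+1 then
  (if err (z k) <= err (m k.+1) then z k else m k.+1) else m 0%N.
have Hz j : [/\ z j != 0, forall i, (`|z j i 0%R| <= 2 ^ j)%N &
    forall y : 'cV[int]_M, y != 0 -> (forall i, (`|y i 0%R| <= 2 ^ j)%N) -> err (z j) <= err y].
  elim: j => [|j [z1 z2 z3]]; first exact: Hm.
  have [m1 m2 m3] := Hm j.+1; rewrite /=.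
  case: ifP => [le|//]; split => // [i|y y0 yj].
    by rewrite (leq_trans (z2 i)) // leq_exp2l.
  exact: le_trans le (m3 _ y0 yj).
exists z => j; have [z1 z2 z3] := Hz j; split=> //=.
case: ifP => [le|/negbT]; [by left|rewrite -ltNge => lt; right].
apply: contrapT => /forallNP h; have [m1 _ _] := Hm j.+1.
suff : err (z j) <= err (m j.+1) by rewrite leNgt lt.
by apply: z3 => // i; rewrite leqNgt; apply/negP/h.
Qed.

(** Transference.  If [z] is an integer vector with [A^T *m z = p' + small], then
    [dot z (A *m q - x - p)] is, up to a small error proportional to [q], an
    integer minus [dot z x].  So a lower bound on the distance from [dot z x]
    to the integers bounds [A *m q - x - p] from below, by a multiple of the
    inverse of [enorm z].  The vector [z] adapted to [q] is the first best
    approximation whose quality is better than a multiple of the inverse of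
    [enorm q]; by Dirichlet's theorem its predecessor, of worse quality, forces
    [enorm q `^ (N / M)] to be at least a multiple of [enorm z]. *)
Lemma bad_of_sequence : exists y : nat -> 'cV[int]_M,
  (forall j, y j = 0 \/
     (2 ^+ j / 2 <= enorm (toR (y j)) /\ enorm (toR (y j)) <= M%:R * 2 ^+ j)) /\
  forall (x : 'cV[R]_M) (e : R), 0 < e ->
    (forall j (n : int), y j != 0 -> e <= `|dot (toR (y j)) x - n%:~R|) -> Bad A x.
Proof.
have [z Hz] := best_sequence.
pose y j := if j is k.+1 then (if z k.+1 == z k then 0 else z k.+1) else z 0%N.
have zy k : exists j, y j = z k /\ y j != 0.
  elim: k => [|k [j [yj yj0]]]; first by exists 0%N; split => //=; have [] := Hz 0%N.
  have [e|ne] := eqVneq (z k.+1) (z k); first by exists j; rewrite e.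
  by exists k.+1; rewrite /= (negbTE ne); have [] := Hz k.+1.
have zle k : enorm (toR (z k)) <= M%:R * 2 ^+ k.
  apply: enorm_le_coord => [|i]; first exact: exprn_ge0.
  have [_ /(_ i) zk _ _] := Hz k.
  by rewrite mxE -intr_norm -abszE -pmulrn -natrX ler_nat.
exists y; split.
  case=> [|k] /=.
    right; split; last exact: zle.
    have [z0 _ _ _] := Hz 0%N.
    have [i zi] : exists i, z 0%N i 0 != 0.
      apply: contrapT => /forallNP h; move/negP: z0; apply; apply/eqP/matrixP => i j.
      by rewrite ord1 mxE; have /negP := h i; rewrite negbK => /eqP.
    rewrite (le_trans _ (coord_le_enorm _ i)) // mxE -intr_norm -abszE -pmulrn expr0.
    rewrite (@le_trans _ _ 1) ?ler1n ?absz_gt0 //.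
    by rewrite ler_pdivrMr // mul1r ler1n.
  case: eqP => [_|ne]; [by left|right; split; last exact: zle].
  have [_ _ _ [//|[i zi]]] := Hz k.
  rewrite exprSr mulfK // (le_trans _ (coord_le_enorm _ i)) // mxE -intr_norm -abszE.
  by rewrite -pmulrn -natrX ler_nat ltnW.
move=> x e e0 yx.
have zx k (n : int) : e <= `|dot (toR (z k)) x - n%:~R|.
  by have [j [<- yj0]] := zy k; apply: yx.
(* the largest [G] allowed by the pigeonhole principle; hence the lower bound
   on [G.+1] *)
have dir k : exists G : nat, [/\ (0 < G)%N, 2 ^+ (k * M) <= ((G.+1)%:R ^+ N : R) &
    err (z k) <= N%:R / G%:R].
  have ex : exists G, (G ^ N < (2 ^ k).+1 ^ M)%N.
    by exists 1%N; rewrite exp1n -{1}(exp1n M) ltn_exp2r // ltnS expn_gt0.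
  have bd G : (G ^ N < (2 ^ k).+1 ^ M)%N -> (G <= (2 ^ k).+1 ^ M)%N.
    move=> h; apply: leq_trans (ltnW h); case: G {h} => // G.
    by rewrite -{1}(expn1 G.+1) leq_pexp2l.
  have [G GH Gmax] := ex_maxnP ex bd; exists G.
  have G0 : (0 < G)%N.
    by apply: Gmax; rewrite exp1n -{1}(exp1n M) ltn_exp2r // ltnS expn_gt0.
  split=> //.
    have : ~~ (G.+1 ^ N < (2 ^ k).+1 ^ M)%N by apply/negP => /Gmax; rewrite ltnn.
    rewrite -leqNgt => h; rewrite -!natrX ler_nat (leq_trans _ h) // expnM leq_exp2r //.
  have [w [w0 wk we]] := dirichlet G0 GH.
  by have [_ _ zmin _] := Hz k; apply: le_trans we; exact: zmin.
have M0 : 0 < M%:R :> R by rewrite ltr0n.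
have N0 : 0 < N%:R :> R by rewrite ltr0n.
pose C : R := (e / (4 * N%:R)) `^ (N%:R / M%:R).
have C0 : 0 < C by rewrite powR_gt0 // divr_gt0 // mulr_gt0.
pose c := Num.min (e / (2 * M%:R)) (C * e / (4 * M%:R)).
have c0 : 0 < c by rewrite lt_min !divr_gt0 ?mulr_gt0.
rewrite /Bad /=; apply: lt_le_trans c0 _; apply: lb_le_inf.
  pose q : 'cV[int]_N := const_mx 1; eexists; exists q => //=.
  apply/eqP => /matrixP/(_ (Ordinal hN) 0); rewrite !mxE.
  by move/eqP; rewrite oner_eq0.
move=> _ [q /= q0 <-].
have q1 : 1 <= enorm (toR q).
  have [i qi] : exists i, q i 0 != 0.
    apply: contrapT => /forallNP h; move/negP: q0; apply; apply/eqP/matrixP => i j.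
    by rewrite ord1 mxE; have /negP := h i; rewrite negbK => /eqP.
  rewrite (le_trans _ (coord_le_enorm _ i)) // mxE -intr_norm -abszE -pmulrn.
  by rewrite ler1n absz_gt0.
have qp : 0 < enorm (toR q) by rewrite (lt_le_trans _ q1).
set Q := enorm (toR q) in q1 qp *.
have Qp : 0 < Q `^ (N%:R / M%:R) by rewrite powR_gt0.
rewrite -ler_pdivrMl //.
apply: le_edist => [|_ [p _ <-]]; first exact: int_points0.
rewrite ler_pdivrMl //; set D := enorm _.
have eQ : 0 < e / (2 * Q) by rewrite divr_gt0 // mulr_gt0.
have ex : exists k, err (z k) < e / (2 * Q).
  pose t := N%:R / (e / (2 * Q)); pose k := Num.bound ((t + 1) ^+ N); exists k.
  have [G [G0 kG zG]] := dir k; apply: le_lt_trans zG _.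
  have GR : 0 < G%:R :> R by rewrite ltr0n.
  rewrite ltr_pdivrMr // -ltr_pdivrMl // [ltLHS]mulrC -/t.
  have t0 : 0 < t by rewrite divr_gt0.
  suff : (t + 1) ^+ N < (G.+1)%:R ^+ N.
    rewrite ltr_pXn2r ?nnegrE //; first by rewrite -natr1 ltrD2r.
    by rewrite addr_ge0 // ltW.
  apply: lt_le_trans kG.
  apply: (@lt_le_trans _ _ k%:R); first by rewrite archi_boundP // exprn_ge0 // addr_ge0 // ltW.
  rewrite -natrX ler_nat ltnW // (leq_trans (ltn_expl k (ltnSn 1))) // leq_exp2l //.
  by rewrite leq_pmulr.
have [k zk kmin] := ex_minnP ex.
have [_ [p' _ <-] zp'] := edist_lt (int_points0 N) zk.
have zD : e / 2 <= enorm (toR (z k)) * D.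
  apply: le_trans (dot_le _ _).
  rewrite !dotBr dot_mulmx -(subrK (toR p') (A^T *m toR (z k))) dotDl.
  have ints : exists n : int, dot (toR p') (toR q) - dot (toR (z k)) (toR p) = n%:~R.
    exists (\sum_i p' i 0 * q i 0 - \sum_i z k i 0 * p i 0).
    rewrite rmorphB /= !rmorph_sum /= /dot.
    by congr (_ - _); apply: eq_bigr => i _; rewrite !mxE rmorphM.
  have [n nE] := ints.
  have h1 := zx k n.
  have h2 : `|dot (A^T *m toR (z k) - toR p') (toR q)| <= e / 2.
    rewrite (le_trans (dot_le _ _)) // (le_trans (ler_wpM2r (ltW qp) (ltW zp'))) //.
    by rewrite invfM mulrA divfK // gt_eqF.
  set u := dot _ (toR q) in h2 *.
  have -> : u + dot (toR p') (toR q) - dot (toR (z k)) x - dot (toR (z k)) (toR p)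
     = u - (dot (toR (z k)) x - n%:~R) by rewrite -nE; ring.
  by rewrite distrC (le_trans _ (lerB_dist _ _)) //; lra.
have D1 : e / (2 * M%:R * 2 ^+ k) <= D.
  rewrite ler_pdivrMr ?mulr_gt0 ?exprn_gt0 //.
  have := le_trans zD (ler_wpM2r (enorm_ge0 _) (zle k)); rewrite -/D; lra.
case: k kmin zk zp' zD D1 => [|k] kmin zk zp' zD D1.
  rewrite ge_min; apply/orP; left; rewrite expr0 mulr1 in D1.
  rewrite (le_trans D1) // ler_peMl ?enorm_ge0 //.
  by rewrite -[leLHS](powRr0 Q) (ler_powR q1) // divr_ge0.
have zk' : e / (2 * Q) <= err (z k) by rewrite leNgt; apply/negP => /kmin; rewrite ltnn.
have [G [G0 kG zG]] := dir k.
have GR : 0 < G%:R :> R by rewrite ltr0n.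
have QG : e / (4 * N%:R) * G.+1%:R <= Q.
  have h := le_trans zk' zG.
  rewrite ler_pdivrMr ?mulr_gt0 // mulrAC ler_pdivlMr // in h.
  have G1 : 1 <= G%:R :> R by rewrite ler1n.
  rewrite mulrAC ler_pdivrMr ?mulr_gt0 // -natr1.
  nra.
have QC : C * 2 ^+ k <= Q `^ (N%:R / M%:R).
  have NM : 0 <= N%:R / M%:R :> R by rewrite divr_ge0.
  apply: le_trans (ge0_ler_powR NM _ _ QG);
    rewrite ?nnegrE ?mulr_ge0 ?divr_ge0 ?(ltW e0) ?(ltW qp) //.
  rewrite powRM ?divr_ge0 ?mulr_ge0 ?(ltW e0) //.
  rewrite ler_wpM2l ?(ltW C0) // powRrM powR_mulrn //.
  have -> : 2 ^+ k = (2 ^+ (k * M)) `^ (M%:R^-1) :> R.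
    rewrite exprM -[X in X `^ _]powR_mulrn ?exprn_ge0 // -powRrM divff ?gt_eqF // powRr1 //.
  by apply: ge0_ler_powR; rewrite ?nnegrE ?invr_ge0 ?exprn_ge0.
rewrite ge_min; apply/orP; right.
apply: le_trans (ler_pM _ _ QC D1).
- rewrite exprS le_eqVlt; apply/orP; left; apply/eqP; field.
  by rewrite expf_neq0 // gt_eqF.
- by rewrite mulr_ge0 ?exprn_ge0 // ltW.
- by rewrite divr_ge0 ?mulr_ge0 ?exprn_ge0 ?(ltW e0).
Qed.

End BestApproximation.

(** * Strict differentiability of C^1 maps *)

Section StrictDifferentiability.
Variables (R : realType) (d : nat).

Lemma derive_along_line (h : 'cV[R]_d -> R) (p w : 'cV[R]_d) (t : R) :
  derivable h (p + t *: w) w ->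
  is_derive t 1 (fun s => h (p + s *: w)) ('D_w h (p + t *: w)).
Proof.
move=> dh.
have E : (fun s => s^-1 *: ((h \o shift (p + t *: w)) (s *: w) - h (p + t *: w))) =
  (fun s => s^-1 *: (((fun s => h (p + s *: w)) \o shift t) (s *: 1) - h (p + t *: w))).
  apply/funext => s /=; congr (_ *: (h _ - _)).
  by rewrite scalerDl -[s *: 1]mulr1 mulr1 addrCA [s%:A]mulr1.
apply: DeriveDef; first by rewrite /derivable -E.
by rewrite /derive -E.
Qed.

Lemma linear_coord (L : {linear 'cV[R]_d -> 'cV[R]_d}) (w : 'cV[R]_d) i :
  L w i 0 = \sum_k w k 0 * L (delta_mx k 0) i 0.
Proof.
rewrite {1}(matrix_sum_delta w) linear_sum summxE; apply: eq_bigr => k _.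
by rewrite big_ord1 linearZ mxE.
Qed.

Lemma coord_sub_le (u v : 'cV[R]_d) i : `|u i 0 - v i 0| <= `|v - u|.
Proof. by have := coord_le_mxnorm (u - v) i; rewrite !mxE distrC [leRHS]distrC. Qed.

(** The mean value theorem along the segment from [z'] to [z], applied to each
    coordinate, gives derivatives at intermediate points; these are close to
    the derivative at [x0] by continuity. *)
Lemma C1_strict (U : set 'cV[R]_d) (f : 'cV[R]_d -> 'cV[R]_d) (x0 : 'cV[R]_d) :
  open U -> C1_on U f -> U x0 ->
  exists D : 'M[R]_d, forall eta : R, 0 < eta -> exists rho : R,
    [/\ 0 < rho, eball x0 rho `<=` U & forall z z', eball x0 rho z -> eball x0 rho z' ->
      enorm (f z - f z' - D *m (z - z')) <= eta * enorm (z - z')].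
Proof.
move=> oU fC1 Ux0.
pose df (x v : 'cV[R]_d) : 'cV[R]_d := 'd f x v.
pose D : 'M[R]_d := \matrix_(i, k) df x0 (delta_mx k 0) i 0.
exists D => eta eta0.
pose tau := eta / (d%:R * d%:R + 1).
have dd0 : 0 < d%:R * d%:R + 1 :> R by rewrite ltr_wpDl.
have tau0 : 0 < tau by rewrite divr_gt0.
have [rho rho0 rhoP] : exists2 rho : R, 0 < rho & eball x0 rho `<=`
  [set x | U x /\ forall k, `|df x0 (delta_mx k 0) - df x (delta_mx k 0)| <= tau].
  apply/nbhs_eball; apply: filterI; first exact: open_nbhs_nbhs.
  apply: (filter_forall (F := nbhs x0) (f := fun (k : 'I_d) x =>
    `|df x0 (delta_mx k 0) - df x (delta_mx k 0)| <= tau)) => k.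
  have [_ /(_ (delta_mx k 0)) c] := fC1 _ Ux0.
  exact: ((@cvgrPdist_le _ _ _ (nbhs x0) _ (fun y => df y (delta_mx k 0))
    (df x0 (delta_mx k 0))).1 c _ tau0).
exists rho; split=> // [z /rhoP[] //|z z' zr zr'].
set w := z - z'.
pose p (t : R) := z' + t *: w.
have pr t : (t \in `]0, 1[) \/ (t \in `[0, 1]) -> eball x0 rho (p t).
  move=> ht; have {ht} /andP[t0 t1] : 0 <= t <= 1.
    by case: ht; rewrite in_itv //= => /andP[/ltW -> /ltW ->].
  rewrite /eball /= /p /w.
  have -> : z' + t *: (z - z') - x0 = t *: (z - x0) + (1 - t) *: (z' - x0).
    by apply/matrixP => i j; rewrite !mxE; ring.
  rewrite (le_trans (enormD _ _)) // !enormZ (ger0_norm t0) ger0_norm ?subr_ge0 //.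
  rewrite /eball /= in zr zr'; move: zr zr'; nra.
have der t i : eball x0 rho (p t) ->
   is_derive t 1 (fun s => f (z' + s *: w) i 0) (df (p t) w i 0).
  move=> /rhoP[Up _]; have [df1 _] := fC1 _ Up.
  have dv : derivable f (p t) w by exact: diff_derivable.
  have -> : df (p t) w i 0 = 'D_w (fun x => f x i 0) (p t).
    by rewrite /df -deriveE // derive_mx // mxE.
  by apply: derive_along_line; move/derivable_mxP: dv => /(_ i 0).
have E i : exists xi, eball x0 rho xi /\ f z i 0 - f z' i 0 = df xi w i 0.
  have [||t t01] := @MVT _ (fun s => f (z' + s *: w) i 0) (fun t => df (p t) w i 0) 0 1 ltr01.
  - by move=> t t01; apply: der; apply: pr; left.
  - apply: derivable_within_continuous => t t01.
    by have [] := der t i (pr t (or_intror t01)).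
  - rewrite subr0 mulr1 scale1r scale0r addr0 /w [z' + _]addrC subrK => e.
    by exists (p t); split => //; apply: pr; left.
have coord i : `|(f z - f z' - D *m w) i 0| <= d%:R * (tau * enorm w).
  have [xi [/rhoP[Uxi xiP] e]] := E i.
  rewrite mxE [X in X + _]mxE [(- f z') i 0]mxE e mxE /df linear_coord mxE -sumrB.
  rewrite (le_trans (ler_norm_sum _ _ _)) //.
  rewrite (@le_trans _ _ (\sum_(k < d) tau * enorm w)) //; last first.
    by rewrite sumr_const card_ord -[leLHS]mulr_natl.
  apply: ler_sum => k _; rewrite !mxE [X in _ - X]mulrC -mulrBr normrM mulrC.
  rewrite ler_pM //; last by have := coord_le_enorm w k; rewrite !mxE.
  rewrite (le_trans _ (xiP k)) //.
  exact: coord_sub_le.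
apply: le_trans (enorm_le_coord _ coord) _; first by rewrite !mulr_ge0 ?enorm_ge0 // ltW.
rewrite mulrA mulrA ler_wpM2r ?enorm_ge0 // /tau mulrA ler_pdivrMr // mulrC.
by rewrite ler_wpM2l ?lerDl // ltW.
Qed.

(** The derivative of a diffeomorphism is injective since the inverse map is
    locally Lipschitz; its transpose is then bounded below. *)
Lemma diffeo_strict (U : set 'cV[R]_d) (f : 'cV[R]_d -> 'cV[R]_d) (x0 : 'cV[R]_d) :
  open U -> C1_diffeo_on U f -> U x0 ->
  exists (D : 'M[R]_d) (c : R), [/\ 0 < c, forall y, c * enorm y <= enorm (D^T *m y) &
    forall eta : R, 0 < eta -> exists rho : R,
    [/\ 0 < rho, eball x0 rho `<=` U & forall z z', eball x0 rho z -> eball x0 rho z' ->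
      enorm (f z - f z' - D *m (z - z')) <= eta * enorm (z - z')]].
Proof.
move=> oU [fC1 oV [g [gC1 gf]]] Ux0.
have [D HD] := C1_strict oU fC1 Ux0.
have Vy0 : (f @` U) (f x0) by exists x0.
have [E HE] := C1_strict oV gC1 Vy0.
have [CE CE0 HCE] := enorm_mulmx_le E.
have [rE [rE0 _ gL]] := HE 1 ltr01.
have inj (v : 'cV[R]_d) : D *m v = 0 -> v = 0.
  move=> Dv; apply: contrapT => /eqP vn0.
  have v0 : 0 < enorm v by rewrite enorm_gt0.
  pose eta := (2 * (CE + 1))^-1.
  have eta0 : 0 < eta by rewrite invr_gt0 mulr_gt0 // addr_gt0.
  have [rho [rho0 rU fL]] := HD _ eta0.
  pose t := Num.min (rho / enorm v) (rE / (eta * enorm v)).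
  have t0 : 0 < t by rewrite lt_min !divr_gt0 // mulr_gt0.
  pose z := x0 + t *: v.
  have zx : z - x0 = t *: v by rewrite /z addrC addKr.
  have zr : eball x0 rho z.
    by rewrite /eball /= zx enormZ gtr0_norm // -ler_pdivlMr // ge_min lexx.
  have xr : eball x0 rho x0 by apply: eball_center; rewrite ltW.
  have := fL _ _ zr xr; rewrite zx -scalemxAr Dv scaler0 subr0 enormZ gtr0_norm // => fz.
  have fr : eball (f x0) rE (f z).
    rewrite /eball /= (le_trans fz) // mulrCA -ler_pdivlMr ?mulr_gt0 //.
    by rewrite /t ge_min lexx orbT.
  have := gL _ _ fr (eball_center _ (ltW rE0)).
  rewrite !gf //; last exact: rU.
  rewrite mul1r zx => h.
  have tv : t * enorm v <= (CE + 1) * enorm (f z - f x0).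
    rewrite -{1}(gtr0_norm t0) -enormZ.
    have := enormD (t *: v - E *m (f z - f x0)) (E *m (f z - f x0)).
    rewrite subrK => /le_trans; apply; rewrite mulrDl mul1r addrC lerD //.
  have tv0 : 0 < t * enorm v by rewrite mulr_gt0.
  have CE1 : 0 < CE + 1 by rewrite addr_gt0.
  have := le_trans tv (ler_wpM2l (ltW CE1) fz).
  have e : (CE + 1) * eta = 1 / 2 by rewrite /eta; field; rewrite gt_eqF.
  rewrite mulrA e; lra.
have Du : D^T \in unitmx.
  rewrite unitmxE unitfE; apply/negP => /det0P[v vn0 vD]; move/negP: vn0; apply.
  rewrite -(trmxK v) (inj v^T) ?trmx0 //.
  by rewrite -(trmxK D) -trmx_mul vD trmx0.
have [C C0 HC] := enorm_mulmx_le (invmx D^T).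
exists D, C^-1; split=> // [|y]; first by rewrite invr_gt0.
by rewrite ler_pdivrMl // (le_trans _ (HC _)) // mulKmx.
Qed.

End StrictDifferentiability.

(** * One move of Alice against finitely many families of hyperplanes *)

Lemma weighted_pigeonhole (R : realType) (I F : finType) (h : I -> F) (k0 : F)
    (P : pred I) (w : I -> R) :
  exists k, \sum_(i | P i) w i <= #|F|%:R * \sum_(i | P i && (h i == k)) w i.
Proof.
pose S k := \sum_(i | P i && (h i == k)) w i.
have [k _ kmax] := @arg_maxP _ _ _ k0 predT S isT.
exists k; rewrite (partition_big h predT) //= mulr_natl -sumr_const.
by apply: ler_sum => k' _; exact: kmax.
Qed.

(** The classes are the cells of a grid on a cube containing the unit ball. *)
Lemma direction_classes (R : realType) (d : nat) (delta : R) : 0 < delta ->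
  exists (F : finType) (h : 'cV[R]_d -> F), forall a a',
    enorm a <= 1 -> enorm a' <= 1 -> h a = h a' -> enorm (a - a') <= delta.
Proof.
move=> d0; pose k := (Num.bound (d%:R / delta : R)).+1.
have kR : 0 < k%:R :> R by rewrite ltr0n.
pose g (a : 'cV[R]_d) i := (a i 0 + 1) * k%:R.
have gb a i : enorm a <= 1 -> 0 <= g a i /\ g a i < (k + k).+1%:R.
  move=> a1; have := le_trans (coord_le_enorm a i) a1.
  rewrite ler_norml => /andP[h1 h2]; split; first by rewrite mulr_ge0 //; lra.
  by rewrite /g -natr1 natrD; nra.
exists {ffun 'I_d -> 'I_(k + k).+1}, (fun a => [ffun i => inord (Num.truncn (g a i))]).
move=> a a' a1 a1' /ffunP e.
apply: le_trans (enorm_le_coord (c := k%:R^-1) _ _) _ => [|i|].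
- by rewrite invr_ge0.
- have [ga ga'] := gb a i a1; have [gb1 gb2] := gb a' i a1'.
  have := e i; rewrite !ffunE => /(congr1 val) /=; rewrite !inordK ?truncn_lt_nat //.
  move=> {}e; have := truncn_itv ga; have := truncn_itv gb1; rewrite -e.
  move=> /andP[t1 t2] /andP[t3 t4]; move: t2 t4; rewrite -natr1 => t2 t4.
  rewrite !mxE -[leRHS]mul1r ler_pdivlMr // -{1}(gtr0_norm kR) -normrM.
  rewrite /g in t1 t2 t3 t4.
  by rewrite ler_norml; apply/andP; split; lra.
rewrite ler_pdivrMr // mulrC -ler_pdivrMr // ltW // (lt_trans (archi_boundP _)) //.
  by rewrite divr_ge0 // ltW.
by rewrite ltr_nat.
Qed.

Lemma int_close (n n' : int) : `|n' - n| < 1 -> n' = n.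
Proof. lia. Qed.

Section OneMove.
Variables (R : realType) (d : nat) (K : set 'cV[R]_d).
Variables (be rK : R).
Hypotheses (be0 : 0 < be) (be1 : be < 1).
Hypothesis diffuse : forall (rho : R) (x a : 'cV[R]_d),
  0 < rho -> rho <= rK -> K x -> a != 0 ->
  exists x', [/\ K x', enorm (x' - x) <= rho & be * rho * enorm a <= `|dot a (x' - x)|].

Let al : R := be / 16.

Variables (Y : nat -> 'cV[R]_d) (m : R).
Hypothesis Ylow : forall j, Y j != 0 -> 2 ^+ j / 2 <= enorm (Y j).
Hypothesis Yup : forall j, enorm (Y j) <= m * 2 ^+ j.

Variables (W : set 'cV[R]_d) (f : 'cV[R]_d -> 'cV[R]_d) (D : 'M[R]_d) (c L : R).
Hypotheses (c0 : 0 < c) (Dc : forall y, c * enorm y <= enorm (D^T *m y)).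
Hypothesis fD : forall z z', W z -> W z' ->
  enorm (f z - f z' - D *m (z - z')) <= al * c * enorm (z - z').
Hypotheses (L0 : 0 <= L)
  (fL : forall z z', W z -> W z' -> enorm (f z - f z') <= L * enorm (z - z')).

Let kappa : R := al * c / 2.

(** The index [j] still has to be dealt with in [b].  The hypersurfaces
    [dot (Y j) (f z) = n] have normals of size comparable to [2 ^+ j], so that
    the condition describes their neighbourhoods of width proportional to the
    radius of the ball.  As this width decreases with the radius, an index which
    is settled in a ball remains so in all balls chosen later. *)
Definition pending (b : gball R d) (j : nat) : Prop :=
  Y j != 0 /\ exists z (n : int), gball_set b z /\
    `|dot (Y j) (f z) - n%:~R| < kappa * (2 ^+ j * b.2).

Lemma kappa_gt0 : 0 < kappa.
Proof. by rewrite !divr_gt0 // mulr_gt0 // divr_gt0. Qed.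

Lemma pending_mono (b b' : gball R d) j : gball_set b' `<=` gball_set b ->
  b'.2 <= b.2 -> pending b' j -> pending b j.
Proof.
move=> sub le [Yj [z [n [zb zn]]]]; split=> //; exists z, n; split; first exact: sub.
by rewrite (lt_le_trans zn) // ler_wpM2l ?(ltW kappa_gt0) // ler_wpM2l.
Qed.

Variable c1 : R.
Hypotheses (c1L : 2 * m * L * c1 <= 1 / 4) (c1k : kappa * c1 <= 1 / 4).

Lemma dot_lin_close j z z' : Y j != 0 -> W z -> W z' ->
  `|dot (Y j) (f z - f z') - dot (D^T *m Y j) (z - z')| <=
     al * enorm (D^T *m Y j) * enorm (z - z').
Proof.
move=> Yj Wz Wz'; rewrite -dot_mulmx -dotBr (le_trans (dot_le _ _)) //.
have h := fD Wz Wz'.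
rewrite (le_trans (ler_wpM2l (enorm_ge0 _) h)) // mulrA ler_wpM2r ?enorm_ge0 //.
by rewrite mulrCA ler_wpM2l ?divr_ge0 ?(ltW be0) // mulrC.
Qed.

(** A move of Alice settles a fixed proportion of the pending indices, for any
    nonnegative weights [w].  The hypersurfaces look flat in the ball, and a heaviest class
    of them has normals close to one vector [a].  Diffuseness gives a point
    [x'] of [K] far from [x] in the direction [a], and none of these
    hypersurfaces can be close to both [x] and [x'], so that one of the two
    points is far from at least half of them, in weight.  The proportion
    depends on [d] and [be] only, and so does the ratio [al] of the radii. *)
Lemma one_move (F : finType) (h : 'cV[R]_d -> F) :
  (forall a a', enorm a <= 1 -> enorm a' <= 1 -> h a = h a' -> enorm (a - a') <= al) ->
  forall (x : 'cV[R]_d) (r : R) (J : nat) (w : nat -> R),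
  K x -> 0 < r -> r <= rK -> eball x r `<=` W ->
  (forall j, (j < J)%N -> 2 ^+ j * r <= c1) -> (forall j, 0 <= w j) ->
  exists x' (Q : pred nat), [/\ K x', enorm (x' - x) <= (1 - al) * r,
    forall j, (j < J)%N -> Q j -> forall b, gball_set b `<=` eball x' (al * r) ->
      b.2 <= r -> ~ pending b j &
    \sum_(j < J | `[< pending (x, r) j >]) w j <=
    2 * #|F|%:R * \sum_(j < J | `[< pending (x, r) j >] && Q j) w j].
Proof.
move=> hF x r J w Kx r0 rr rW act w0.
have al0 : 0 < al by rewrite divr_gt0.
have al16 : 16 * al < 1 by rewrite /al mulrC divfK // pnatr_eq0.
pose P j := `[< pending (x, r) j >].
pose nrm j := (enorm (D^T *m Y j))^-1 *: (D^T *m Y j).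
have v0 j : P j -> 0 < enorm (D^T *m Y j).
  by move=> /asboolP[Yj _]; apply: lt_le_trans (Dc _); rewrite mulr_gt0 // enorm_gt0.
have nrm1 j : P j -> enorm (nrm j) = 1.
  by move=> /v0 vj; rewrite enormZ ger0_norm ?invr_ge0 ?enorm_ge0 // mulVf // gt_eqF.
have [k kP] := weighted_pigeonhole (fun j : 'I_J => h (nrm j)) (h 0) (fun j => P j)
  (fun j => w j).
have [/existsP[js /andP[Pjs /eqP hjs]]|] :=
    boolP [exists j : 'I_J, P j && (h (nrm j) == k)]; last first.
  rewrite negb_exists => /forallP none; exists x, (fun=> false); split=> //.
    by rewrite subrr enorm0 mulr_ge0 ?(ltW r0) //; lra.
  apply: le_trans kP _; rewrite [leLHS](_ : _ = 0) ?mulr_ge0 //.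
    by apply: sumr_ge0 => j _; exact: w0.
  by rewrite big1 ?mulr0 // => j; rewrite (negbTE (none j)).
pose a := nrm js; have a1 : enorm a = 1 by exact: nrm1.
have [|||x' [Kx' x'x ax']] := diffuse (rho := (1 - al) * r) (x := x) (a := a) _ _ Kx.
- by rewrite mulr_gt0 //; lra.
- by apply: le_trans rr; rewrite ger_pMl //; lra.
- by rewrite -enorm_gt0 a1.
have xb : eball x r x by apply: eball_center; exact: ltW.
have xb' : eball x r x'.
  by rewrite /eball /= (le_trans x'x) // ger_pMl //; lra.
have /choice[n Hn] : forall j, exists n : int, P j -> exists z, eball x r z /\
    `|dot (Y j) (f z) - n%:~R| < kappa * (2 ^+ j * r).
  move=> j; have [/asboolP[_ [z [n [zb zn]]]]|nP] := boolP (P j); last by exists 0.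
  by exists n => _; exists z.
pose Q (p : 'cV[R]_d) j :=
  P j && (3 * al * r * enorm (D^T *m Y j) <= `|dot (Y j) (f p) - (n j)%:~R|).
(* as [2 ^+ j * r <= c1], no integer other than [n j] can come into play in the
   whole ball *)
have kill p j : eball x r p -> (eball p (al * r) `<=` eball x r) -> (j < J)%N -> Q p j ->
    forall b : gball R d, gball_set b `<=` eball p (al * r) -> b.2 <= r -> ~ pending b j.
  move=> pb psub jJ /andP[Pj Qj] b bsub br [Yj [z [n' [zb zn']]]].
  have zp := bsub _ zb; have zx := psub _ zp.
  have [z0 [z0x z0n]] := Hn j Pj.
  have jc1 := act j jJ.
  have kr : kappa * (2 ^+ j * r) <= 1 / 4.
    by apply: le_trans c1k; rewrite ler_wpM2l ?(ltW kappa_gt0).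
  have zn : `|dot (Y j) (f z) - n'%:~R| < kappa * (2 ^+ j * r).
    by apply: lt_le_trans zn' _; rewrite ler_wpM2l ?(ltW kappa_gt0) // ler_wpM2l.
  have dist : `|dot (Y j) (f z) - dot (Y j) (f z0)| <= 1 / 4.
    rewrite -dotBr (le_trans (dot_le _ _)) //.
    have zz0 : enorm (z - z0) <= 2 * r.
      have := enorm_triangle x z z0; rewrite (enormB x z0).
      by rewrite /eball /= in zx z0x; move: zx z0x; lra.
    have h1 := le_trans (fL (rW _ zx) (rW _ z0x)) (ler_wpM2l L0 zz0).
    have m0 : 0 <= m * 2 ^+ j by exact: le_trans (enorm_ge0 _) (Yup j).
    have h2 := ler_pM (enorm_ge0 _) (enorm_ge0 _) (Yup j) h1.
    apply: le_trans h2 _; apply: le_trans c1L.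
    have -> : m * 2 ^+ j * (L * (2 * r)) = 2 * m * L * (2 ^+ j * r) by ring.
    rewrite ler_wpM2l // mulr_ge0 // mulr_ge0 //.
    by rewrite pmulr_lge0 // exprn_gt0 in m0.
  have en : n' = n j.
    apply: int_close.
    rewrite -(ltr_int R) intr_norm rmorphB /=.
    move: zn z0n dist kr; set u := dot _ _; set v := dot _ _.
    rewrite !ltr_norml ler_norml => /andP[? ?] /andP[? ?] /andP[? ?] ?.
    by apply/andP; split; lra.
  subst n'; have close := dot_lin_close Yj (rW _ zx) (rW _ pb).
  have h1 := dot_le (D^T *m Y j) (z - p).
  have V0 := enorm_ge0 (D^T *m Y j).
  have h2 : enorm (D^T *m Y j) * enorm (z - p) <= enorm (D^T *m Y j) * (al * r).
    by rewrite ler_wpM2l.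
  have low : kappa * (2 ^+ j * r) <= al * r * enorm (D^T *m Y j).
    apply: (@le_trans _ _ (al * r * (c * enorm (Y j)))).
      have := Ylow Yj; rewrite /kappa => yl.
      have -> : al * c / 2 * (2 ^+ j * r) = al * r * c * (2 ^+ j / 2) by ring.
      by rewrite [leRHS]mulrA ler_wpM2l // mulr_ge0 ?(ltW c0) // mulr_ge0 // ltW.
    by rewrite ler_wpM2l // mulr_ge0 // ltW.
  rewrite dotBr in close.
  move: close h1 h2 low zn Qj; set V := enorm (D^T *m Y j) in V0 *.
  set E := enorm (z - p); set s := dot _ (z - p).
  set u := dot _ (f z); set v := dot _ (f p) => close h1 h2 low zn Qj.
  have close' : al * V * E <= V * (al * r).
    rewrite -mulrA; apply: (@le_trans _ _ (V * E)) => //.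
    by rewrite ler_piMl //; [exact: mulr_ge0 V0 (enorm_ge0 _)|lra].
  have t1 : `|v - (n j)%:~R| <= `|u - (n j)%:~R| + `|u - v|.
    by rewrite -(subrKA u) addrC (distrC u v) ler_normD.
  have t2 : `|u - v| <= `|u - v - s| + `|s| by rewrite -{1}(subrK s (u - v)) ler_normD.
  lra.
(* the distance from [x] to [x'] along the normal exceeds twice the distance to
   the hypersurface which is required in [Q] *)
have cover j : P j -> h (nrm j) = k -> Q x j || Q x' j.
  move=> Pj hj; rewrite /Q Pj /= !leNgt -negb_and; apply/negP => /andP[q1 q2].
  have [Yj _] := asboolP _ Pj.
  have aj : enorm (nrm j - a) <= al by apply: hF; rewrite ?nrm1 // hjs.
  have vE : D^T *m Y j = enorm (D^T *m Y j) *: nrm j.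
    by rewrite scalerA mulfV ?scale1r // gt_eqF // v0.
  have close := dot_lin_close Yj (rW _ xb') (rW _ xb).
  have Vp := v0 j Pj.
  have h1 : be * ((1 - al) * r) - al * r <= `|dot (nrm j) (x' - x)|.
    have := dot_le (nrm j - a) (x' - x); rewrite dotBl.
    have : enorm (nrm j - a) * enorm (x' - x) <= al * r.
      by apply: ler_pM; rewrite ?enorm_ge0 // (le_trans x'x) // ger_pMl //; lra.
    move: ax'; rewrite a1 mulr1; set s := dot a _; set t := dot (nrm j) _ => g1 g2 g3.
    have : `|s| <= `|t - s| + `|t| by rewrite -{1}(subrK t s) distrC ler_normD.
    lra.
  have h2 : 8 * al * r <= `|dot (nrm j) (x' - x)|.
    apply: le_trans h1; have -> : be = 16 * al by rewrite /al mulrC divfK // pnatr_eq0.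
    rewrite -subr_ge0 (_ : _ - _ = al * r * (7 - 16 * al)); last by ring.
    by rewrite mulr_ge0 ?mulr_ge0 ?ltW //; lra.
  have h3 : enorm (D^T *m Y j) * (8 * al * r) <= `|dot (D^T *m Y j) (x' - x)|.
    by rewrite {2}vE dotZl normrM (gtr0_norm Vp) ler_wpM2l // ltW.
  have h4 : al * enorm (D^T *m Y j) * enorm (x' - x) <= enorm (D^T *m Y j) * (al * r).
    have e : enorm (x' - x) <= r by rewrite (le_trans x'x) // ger_pMl //; lra.
    by rewrite (mulrC al) -mulrA; apply: ler_wpM2l (ltW Vp) _ _ (ler_wpM2l (ltW al0) e).
  rewrite dotBr in close; have alV : 0 < al * r * enorm (D^T *m Y j) by rewrite !mulr_gt0.
  move: close h3 h4 q1 q2 alV; set V := enorm (D^T *m Y j); set s := dot (D^T *m Y j) _.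
  set E := al * V * _; set u := dot _ (f x'); set v := dot _ (f x) => close h3 h4 q1 q2 alV.
  have t1 : `|u - v| <= `|u - (n j)%:~R| + `|v - (n j)%:~R|.
    by rewrite -(subrKA (n j)%:~R) (distrC v) ler_normD.
  have t2 : `|s| <= `|u - v - s| + `|u - v| by rewrite -{1}(subrK (u - v) s) distrC ler_normD.
  lra.
pose S p := \sum_(j < J | P j && Q p j) w j.
have split2 : \sum_(j < J | P j && (h (nrm j) == k)) w j <= S x + S x'.
  rewrite /S [X in _ <= X + _]big_mkcond [X in _ <= _ + X]big_mkcond /= -big_split /=.
  rewrite big_mkcond; apply: ler_sum => j _.
  case: ifP => [/andP[Pj /eqP hj]|_].
    have := cover j Pj hj; have := w0 j.
    by rewrite Pj /=; do 2 case: (Q _ j) => //=; rewrite ?addr0 ?add0r // lerDl.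
  by rewrite addr_ge0 //; case: ifP.
have in_x : eball x (al * r) `<=` eball x r.
  by apply: eball_sub; rewrite subrr enorm0 add0r ger_pMl //; lra.
have in_x' : eball x' (al * r) `<=` eball x r.
  by apply: eball_sub; rewrite (le_trans (lerD x'x (lexx _))) // -mulrDl subrK mul1r.
have F0 : 0 <= #|F|%:R :> R by [].
have [le|/ltW le] := leP (S x') (S x).
  exists x, (Q x); split=> //; first by rewrite subrr enorm0 mulr_ge0 ?(ltW r0) //; lra.
    by move=> j jJ Qj; exact: kill.
  apply: le_trans kP _; rewrite -/(S x) (mulrC 2) -mulrA ler_wpM2l // (le_trans split2) //; lra.
exists x', (Q x'); split=> //; first by move=> j jJ Qj; exact: kill.
apply: le_trans kP _; rewrite -/(S x') (mulrC 2) -mulrA ler_wpM2l // (le_trans split2) //; lra.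
Qed.

End OneMove.

(** * Winning for one diffeomorphism *)

Lemma geometric_tail (R : realFieldType) (u : R) (a b : nat) : 0 <= u -> u < 1 ->
  \sum_(a <= j < b) u ^+ j <= u ^+ a / (1 - u).
Proof.
move=> u0 u1; have p : 0 < 1 - u by rewrite subr_gt0.
rewrite ler_pdivlMr //; have [ba|/ltnW ab] := leqP b a.
  by rewrite big_geq // mul0r exprn_ge0.
suff sumE n : (\sum_(a <= j < a + n) u ^+ j) * (1 - u) = u ^+ a - u ^+ (a + n).
  by rewrite -(subnKC ab) sumE gerBl exprn_ge0.
elim: n => [|n IH]; first by rewrite addn0 big_geq // mul0r subrr.
by rewrite addnS big_nat_recr ?leq_addr //= mulrDl IH exprS; ring.
Qed.

(** The strategy depends on the last ball of Bob only: it can be adopted in the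
    middle of a play, the ball [C] becoming the first one. *)
Definition positional_win (R : realType) (d : nat) (K : set 'cV[R]_d) (al be : R)
    (T : set 'cV[R]_d) (C : gball R d) : Prop :=
  exists phi : gball R d -> gball R d,
  (forall B, K B.1 -> 0 < B.2 ->
     [/\ K (phi B).1, (phi B).2 = al * B.2 & gball_set (phi B) `<=` gball_set B]) /\
  forall B : nat -> gball R d, B 0%N = C -> (forall k, K (B k).1 /\ 0 < (B k).2) ->
    (forall k, (B k.+1).2 = be * (phi (B k)).2 /\
               gball_set (B k.+1) `<=` gball_set (phi (B k))) ->
    \bigcap_n gball_set (B n) `<=` T.

Section Potential.
Variables (R : realType) (d : nat) (K : set 'cV[R]_d).
Variables (be rK : R).
Hypotheses (be0 : 0 < be) (be1 : be < 1).
Hypothesis diffuse : forall (rho : R) (x a : 'cV[R]_d),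
  0 < rho -> rho <= rK -> K x -> a != 0 ->
  exists x', [/\ K x', enorm (x' - x) <= rho & be * rho * enorm a <= `|dot a (x' - x)|].

Let al : R := be / 16.

Variables (Y : nat -> 'cV[R]_d) (m : R).
Hypothesis m0 : 0 <= m.
Hypothesis Ylow : forall j, Y j != 0 -> 2 ^+ j / 2 <= enorm (Y j).
Hypothesis Yup : forall j, enorm (Y j) <= m * 2 ^+ j.

Variables (W : set 'cV[R]_d) (f : 'cV[R]_d -> 'cV[R]_d) (D : 'M[R]_d) (c L : R).
Hypotheses (c0 : 0 < c) (Dc : forall y, c * enorm y <= enorm (D^T *m y)).
Hypothesis fD : forall z z', W z -> W z' ->
  enorm (f z - f z' - D *m (z - z')) <= al * c * enorm (z - z').
Hypotheses (L0 : 0 <= L)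
  (fL : forall z z', W z -> W z' -> enorm (f z - f z') <= L * enorm (z - z')).

Definition escapes : set 'cV[R]_d :=
  [set x | exists2 e : R, 0 < e & forall j (n : int), Y j != 0 ->
     e <= `|dot (Y j) (f x) - n%:~R|].

(** The potential of a ball of radius [r] is the sum of [u ^+ j] over the
    pending indices [j] with [2 ^+ j * r <= c1].  A move of Alice multiplies it
    by a factor less than [1], up to the indices that become visible at the new
    scale, which contribute at most a multiple of [r `^ s], where
    [2 `^ (- s) = u].  For small [s] this keeps the potential below a multiple
    of [r `^ s], so that an index [j] cannot remain pending when [2 ^+ j * r]
    is small: at that time [dot (Y j) (f z)] is known to stay away from the
    integers by an amount independent of [j].  An index waits several moves,
    because Bob may shrink the balls so much between two moves that more
    hyperplanes appear than one move can settle. *)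
Lemma escapes_positional (be' : R) (C : gball R d) : 0 < be' -> be' < 1 ->
  0 < C.2 -> C.2 <= rK -> gball_set C `<=` W ->
  positional_win K al be' escapes C.
Proof.
move=> b0 b1 C0 CrK CW.
have al0 : 0 < al by rewrite divr_gt0.
have al16 : 16 * al < 1 by rewrite /al mulrC divfK // pnatr_eq0.
have [F [h hF]] := direction_classes d al0.
pose kappa : R := al * c / 2.
have kap0 : 0 < kappa by exact: kappa_gt0.
pose c1 : R := (4 * (2 * m * L + kappa + 1))^-1.
have mL : 0 <= 2 * m * L by rewrite !mulr_ge0.
have den : 0 < 4 * (2 * m * L + kappa + 1) by rewrite mulr_gt0 //; lra.
have c1p : 0 < c1 by rewrite invr_gt0.
have c1L : 2 * m * L * c1 <= 1 / 4 by rewrite ler_pdivrMr //; lra.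
have c1k : kappa * c1 <= 1 / 4 by rewrite ler_pdivrMr //; lra.
pose pend := pending be Y f c.
pose q : R := 2 * #|F|%:R.
have F1 : 1 <= #|F|%:R :> R by rewrite ler1n; apply/card_gt0P; exists (h 0).
have q2 : 2 <= q by rewrite /q; lra.
pose lam := al * be'.
have lam0 : 0 < lam by rewrite mulr_gt0.
have lam1 : lam < 1 by rewrite /lam; nra.
(* [s] is such that the factor [lam `^ s], by which the bound decreases in one
   round, is [1 - (2 * q)^-1], while Alice ensures a factor [1 - q^-1] *)
pose th : R := 1 - (2 * q)^-1.
have qi : 0 < (2 * q)^-1 by rewrite invr_gt0; lra.
have qi1 : (2 * q)^-1 < 1 by rewrite invf_lt1; lra.
have th0 : 0 < th by rewrite /th; lra.
have th1 : th < 1 by rewrite /th; lra.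
pose s : R := ln th / ln lam.
have s0 : 0 < s by rewrite /s -mulrNN -invrN divr_gt0 // oppr_gt0 ln_lt0 // ?th0 ?lam0.
have lams : lam `^ s = th.
  rewrite /powR gt_eqF // /s divfK ?lnK //.
  by rewrite lt_eqF // ln_lt0 // lam0.
pose u : R := 2 `^ (- s).
have u0 : 0 < u by rewrite powR_gt0.
have u1 : u < 1.
  by rewrite /u powRN invf_lt1 ?powR_gt0 // /powR pnatr_eq0 /= expR_gt1 mulr_gt0 // ln_gt0 // ltr1n.
have uj j : u ^+ j = (2 ^+ j) `^ (- s).
  by rewrite /u -powR_mulrn ?powR_ge0 // -powRrM mulrC powRrM powR_mulrn.
have /choice[J HJ] : forall r : R, exists J : nat, 0 < r ->
    (forall j, (j < J)%N -> 2 ^+ j * r <= c1) /\ c1 < 2 ^+ J * r.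
  move=> r; have [r0|] := ltP 0 r; last by exists 0%N.
  have ex : exists J : nat, c1 < 2 ^+ J * r.
    exists (Num.bound (c1 / r)); rewrite -ltr_pdivrMr //.
    apply: (lt_trans (archi_boundP (divr_ge0 (ltW c1p) (ltW r0)))).
    by rewrite -natrX ltr_nat ltn_expl.
  have [n nP nmin] := ex_minnP ex; exists n => _; split=> // j jn.
  by rewrite leNgt; apply/negP => /nmin; rewrite leqNgt jn.
pose V (B : gball R d) : R := \sum_(j < J B.2 | `[< pend B j >]) u ^+ j.
have /choice[phi Hphi] : forall B : gball R d, exists A : gball R d,
  (K B.1 -> 0 < B.2 ->
     [/\ K A.1, A.2 = al * B.2 & gball_set A `<=` gball_set B]) /\
  (K B.1 -> 0 < B.2 -> B.2 <= rK -> gball_set B `<=` W -> exists Q : pred nat,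
     (forall j, (j < J B.2)%N -> Q j -> forall b, gball_set b `<=` gball_set A ->
      b.2 <= B.2 -> ~ pend b j) /\
     V B <= q * \sum_(j < J B.2 | `[< pend B j >] && Q j) u ^+ j).
  move=> B; have [[KB B0 BrK BW]|nB] := pselect [/\ K B.1, 0 < B.2, B.2 <= rK & gball_set B `<=` W].
    have [Jact _] := HJ _ B0.
    have [x' [Q [Kx' x'x kill le]]] := one_move be0 be1 diffuse Ylow Yup c0 Dc fD L0 fL
      c1L c1k hF KB B0 BrK BW Jact (fun j => exprn_ge0 j (ltW u0)).
    exists (x', al * B.2); split=> [_ _|_ _ _ _].
      split=> //=; apply: eball_sub; rewrite /= (le_trans (lerD x'x (lexx _))) //.
      by rewrite -mulrDl subrK mul1r.
    by exists Q; split=> //; move: le; rewrite -surjective_pairing.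
  exists (B.1, al * B.2); split=> [KB B0|KB B0 BrK BW]; last by case: nB.
  split=> //=; apply: eball_sub; rewrite subrr enorm0 add0r /= ger_pMl //; lra.
exists phi; split=> [B KB B0|B BC KB Bphi]; first by have [/(_ KB B0)] := Hphi B.
have rS k : (B k.+1).2 = lam * (B k).2.
  have [K1 K2] := KB k; have [/(_ K1 K2)[_ e _] _] := Hphi (B k).
  by have [-> _] := Bphi k; rewrite e mulrA [be' * al]mulrC.
have rk k : (B k).2 = lam ^+ k * C.2.
  by elim: k => [|k IH]; rewrite ?BC ?mul1r // rS IH mulrA -exprS.
have sub k : gball_set (B k.+1) `<=` gball_set (B k).
  have [K1 K2] := KB k; have [/(_ K1 K2)[_ _ e] _] := Hphi (B k).
  by have [_ le] := Bphi k; apply: subset_trans le e.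
have subW k : gball_set (B k) `<=` W.
  by elim: k => [|k IH]; [rewrite BC|apply: subset_trans (sub k) IH].
have rdec k : (B k.+1).2 <= (B k).2 by rewrite rS ger_pMl ?(ltW lam1) //; have [] := KB k.
have rkK k : (B k).2 <= rK.
  by elim: k => [|k IH]; [rewrite BC|apply: le_trans (rdec k) IH].
pose E : R := (c1 `^ (- s)) / (1 - u).
have E0 : 0 < E by rewrite divr_gt0 ?powR_gt0 // subr_gt0.
have step k : V (B k.+1) <= (1 - q^-1) * V (B k) + E * (B k).2 `^ s.
  have [K1 K2] := KB k; have [_ K2'] := KB k.+1.
  have [_ /(_ K1 K2 (rkK k) (subW k))[Q [kill le]]] := Hphi (B k).
  have [act1 big1] := HJ _ K2; have [act2 big2] := HJ _ K2'.
  have JJ : (J (B k).2 <= J (B k.+1).2)%N.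
    rewrite leqNgt; apply/negP => lt; have := act1 _ lt; rewrite leNgt => /negP; apply.
    by apply: lt_le_trans big2 _; rewrite ler_wpM2l // exprn_ge0.
  have tail : u ^+ J (B k).2 / (1 - u) <= E * (B k).2 `^ s.
    rewrite mulrAC ler_wpM2r ?invr_ge0 ?subr_ge0 ?(ltW u1) // uj !powRN.
    have lt : c1 `^ s <= (2 ^+ J (B k).2) `^ s * (B k).2 `^ s.
      rewrite -powRM ?exprn_ge0 ?(ltW K2) //.
      apply: (ge0_ler_powR (ltW s0) _ _ (ltW big1)); rewrite nnegrE; first exact: ltW.
      by apply: mulr_ge0; [exact: exprn_ge0|exact: ltW].
    rewrite mulrC ler_pdivlMr ?powR_gt0 // mulrC ler_pdivrMr ?powR_gt0 ?exprn_gt0 //.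
    by rewrite mulrC.
  pose S := \sum_(j < J (B k).2 | `[< pend (B k) j >] && Q j) u ^+ j.
  have head : \sum_(j < J (B k).2 | `[< pend (B k.+1) j >]) u ^+ j <= V (B k) - S.
    have -> : V (B k) = S + \sum_(j < J (B k).2 | `[< pend (B k) j >] && ~~ Q j) u ^+ j.
      by rewrite /V (bigID (fun j : 'I__ => Q j)).
    rewrite [S + _]addrC addrK.
    rewrite big_mkcond [X in _ <= X]big_mkcond; apply: ler_sum => j _.
    case: ifP => [/asboolP p|_]; last by case: ifP => // _; rewrite exprn_ge0 // ltW.
    have -> : `[< pend (B k) j >] by apply/asboolP; exact: pending_mono p.
    have [Qj|//] := boolP (Q j).
    by case: (kill j (ltn_ord j) Qj (B k.+1) _ _ p) => //; have [] := Bphi k.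
  have VS : (1 - q^-1) * V (B k) >= V (B k) - S.
    rewrite mulrBl mul1r lerD2l lerN2 mulrC ler_pdivrMr; last by lra.
    by rewrite mulrC.
  rewrite {1}/V -(big_mkord (fun j => `[< pend (B k.+1) j >]) (fun j => u ^+ j)).
  rewrite (big_cat_nat (leq0n _) JJ) //= lerD //.
    by rewrite big_mkord (le_trans head).
  apply: le_trans tail; apply: le_trans (geometric_tail _ _ (ltW u0) u1).
  rewrite big_mkcond /=; apply: ler_sum => j _; case: ifP => // _.
  by rewrite exprn_ge0 // ltW.
pose G : R := Num.max (V C / C.2 `^ s) (E * (2 * q)).
have q0 : 0 < 2 * q by lra.
have G0 : 0 < G by rewrite lt_max (mulr_gt0 E0 q0) orbT.
have bound k : V (B k) <= G * (B k).2 `^ s.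
  elim: k => [|k IH].
    by rewrite BC -ler_pdivrMr ?powR_gt0 // le_max lexx.
  apply: le_trans (step k) _; rewrite rS powRM ?(ltW lam0) //; last by have [_ /ltW] := KB k.
  rewrite lams; have rs : 0 <= (B k).2 `^ s by exact: powR_ge0.
  have q1 : 0 <= 1 - q^-1 by rewrite subr_ge0 invf_le1; lra.
  have := ler_wpM2l q1 IH; have EG : E <= G / (2 * q).
    by rewrite ler_pdivlMr ?le_max ?lexx ?orbT //; lra.
  have := ler_wpM2r rs EG.
  rewrite /th; have -> : (2 * q)^-1 = q^-1 / 2 by rewrite invfM mulrC.
  set v := _ `^ s; set i := q^-1; nra.
pose e1 : R := (G + 1)^-1 `^ s^-1.
have e10 : 0 < e1 by rewrite powR_gt0 // invr_gt0; lra.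
pose e2 := Num.min c1 e1.
have e20 : 0 < e2 by rewrite lt_min c1p.
have settled k j : 2 ^+ j * (B k).2 < e2 -> ~ pend (B k) j.
  rewrite lt_min => /andP[l1 l2] p; have [_ K2] := KB k.
  have [act1 big1] := HJ _ K2.
  have jJ : (j < J (B k).2)%N.
    rewrite ltnNge; apply/negP => Jj; have := lt_trans l1 big1.
    by rewrite ltr_pM2r // ltr_eXn2l ?ltr1n // ltnNge Jj.
  have uV : u ^+ j <= V (B k).
    rewrite /V (bigD1 (Ordinal jJ)) /=; last exact/asboolP.
    by rewrite lerDl; apply: sumr_ge0 => i _; rewrite exprn_ge0 // ltW.
  have := le_trans uV (bound k); rewrite uj powRN.
  have pj : 0 < (2 ^+ j : R) `^ s by rewrite powR_gt0 // exprn_gt0.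
  rewrite -[leLHS]mul1r ler_pdivrMr // -mulrA -powRM ?exprn_ge0 ?(ltW K2) //.
  have : (2 ^+ j * (B k).2) `^ s < (G + 1)^-1.
    have -> : (G + 1)^-1 = e1 `^ s.
      by rewrite -powRrM mulVf ?powRr1 ?invr_ge0 ?gt_eqF //; lra.
    rewrite gt0_ltr_powR // nnegrE ?(ltW e10) // mulr_ge0 ?exprn_ge0 // ltW //.
  move=> h1; rewrite (mulrC (B k).2) leNgt => /negP; apply.
  apply: lt_le_trans (_ : G * (G + 1)^-1 <= _); first by rewrite ltr_pM2l.
  by rewrite ler_pdivrMr; lra.
move=> x xB; exists (kappa * Num.min C.2 (lam * e2)).
  by rewrite mulr_gt0 // lt_min C0 mulr_gt0.
move=> j n Yj.
have ex : exists k, 2 ^+ j * (B k).2 < e2.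
  have lamk : lam ^+ k @[k --> \oo] --> (0 : R).
    by apply: cvg_expr; rewrite ger0_norm // ltW.
  have e0 : 0 < e2 / (2 ^+ j * C.2) by rewrite divr_gt0 // mulr_gt0 // exprn_gt0.
  move/cvgrPdist_lt: lamk => /(_ _ e0)[k _ /(_ k (leqnn k))] /=.
  rewrite sub0r normrN ger0_norm ?exprn_ge0 ?(ltW lam0) // => lt; exists k.
  by rewrite rk mulrCA -ltr_pdivlMr // mulr_gt0 // exprn_gt0.
have [k kP kmin] := ex_minnP ex.
have low : Num.min C.2 (lam * e2) <= 2 ^+ j * (B k).2.
  case: k kP kmin => [|k] kP kmin.
    by rewrite ge_min BC ler_peMl ?(ltW C0) // exprn_ege1 // ler1n.
  rewrite ge_min rS mulrCA ler_wpM2l ?orbT ?(ltW lam0) // leNgt.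
  by apply/negP => /kmin; rewrite ltnn.
rewrite (le_trans (ler_wpM2l (ltW kap0) low)) // leNgt; apply/negP => lt.
by apply: (settled _ _ kP); split=> //; exists x, n; split=> //; exact: xB.
Qed.

End Potential.

(** * General facts on Schmidt's game *)

Section Game.
Variables (R : realType) (d : nat) (K : set 'cV[R]_d).
Implicit Types (T : set 'cV[R]_d) (B : nat -> gball R d) (sigma : strategy R d).

Lemma bob_legal_upto_le be sigma B m n : (m <= n)%N ->
  bob_legal_upto K be sigma B n -> bob_legal_upto K be sigma B m.
Proof.
by move=> mn [KB0 B0 Bk]; split=> // k km; apply: Bk; exact: leq_trans km mn.
Qed.

Section Play.
Variables (al be : R) (sigma : strategy R d) (B : nat -> gball R d).
Hypotheses (al0 : 0 < al) (be0 : 0 < be).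

Lemma play_pos n : bob_legal_upto K be sigma B n ->
  (forall m, (m < n)%N -> alice_legal_at K al sigma B m) -> K (B n).1 /\ 0 < (B n).2.
Proof.
elim: n => [|n IH] bob alice; first by have [? ? _] := bob.
have [_ Bn] := IH (bob_legal_upto_le (leqnSn n) bob) (fun m mn => alice m (ltnW mn)).
have [_ _ /(_ n (ltnSn n))[KB -> _]] := bob.
by have [_ -> _] := alice n (ltnSn n); split=> //; rewrite !mulr_gt0.
Qed.

Lemma play_step n m : bob_legal_upto K be sigma B n ->
  (forall m, (m < n)%N -> alice_legal_at K al sigma B m) -> (m < n)%N ->
  (B m.+1).2 = al * be * (B m).2 /\ gball_set (B m.+1) `<=` gball_set (B m).
Proof.
move=> bob alice mn; have [_ _ /(_ m mn)[_ -> s1]] := bob.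
have [_ -> s2] := alice m mn; split; first by rewrite mulrA [be * al]mulrC.
exact: subset_trans s1 s2.
Qed.

Lemma play_steps n m t : bob_legal_upto K be sigma B n ->
  (forall m, (m < n)%N -> alice_legal_at K al sigma B m) -> (m + t <= n)%N ->
  (B (m + t)%N).2 = (al * be) ^+ t * (B m).2 /\
  gball_set (B (m + t)%N) `<=` gball_set (B m).
Proof.
move=> bob alice; elim: t => [|t IH]; first by rewrite addn0 mul1r; split.
rewrite addnS => mtn; have [IH1 IH2] := IH (ltnW mtn).
have [e s] := play_step bob alice mtn.
by rewrite e IH1 mulrA exprS; split=> //; exact: subset_trans s IH2.
Qed.

End Play.

Section InfinitePlay.
Variables (al be : R) (sigma : strategy R d) (B : nat -> gball R d).
Hypotheses (al0 : 0 < al) (al1 : al < 1) (be0 : 0 < be) (be1 : be < 1).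
Hypothesis bob : forall n, bob_legal_upto K be sigma B n.
Hypothesis alice : forall n, bob_legal_upto K be sigma B n -> alice_legal_at K al sigma B n.

Lemma play_center n : K (B n).1 /\ 0 < (B n).2.
Proof. apply: (play_pos al0 be0 (bob n)) => m _; exact: alice. Qed.

Lemma play_radius n : (B n).2 = (al * be) ^+ n * (B 0%N).2.
Proof.
by have [] := play_steps (bob n) (fun m _ => alice (bob m)) (leqnn (0 + n)).
Qed.

Lemma play_radius_small (e : R) : 0 < e -> exists n, (B n).2 < e.
Proof.
move=> e0; have [_ B0] := play_center 0.
have ab0 : 0 < al * be by rewrite mulr_gt0.
have lamk : (al * be) ^+ k @[k --> \oo] --> (0 : R).
  by apply: cvg_expr; rewrite ger0_norm; [rewrite mulr_ilt1 ?ltW|rewrite ltW].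
have e1 : 0 < e / (B 0%N).2 by rewrite divr_gt0.
move/cvgrPdist_lt: lamk => /(_ _ e1)[k _ /(_ k (leqnn k))] /=.
rewrite sub0r normrN ger0_norm ?exprn_ge0 ?(ltW ab0) // => lt; exists k.
by rewrite play_radius -ltr_pdivlMr.
Qed.

Lemma play_in_closed x : closed K -> (\bigcap_n gball_set (B n)) x -> K x.
Proof.
move=> cK xB; apply: (closed_enorm cK) => rho r0.
have [n Bn] := play_radius_small r0; exists (B n).1; first by have [] := play_center n.
by rewrite enormB (le_trans (xB n I)) // ltW.
Qed.

End InfinitePlay.

Lemma alpha_winning_closed al T : 0 < al -> al < 1 -> closed K ->
  alpha_winning_on K al T -> alpha_winning_on K al (K `&` T).
Proof.
move=> al0 al1 cK win be be0 be1; have [sigma Hs] := win be be0 be1.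
exists sigma => B; have [legal wins] := Hs B; split=> // bob x xB; split.
  exact: (play_in_closed al0 al1 be0 be1 bob legal cK).
exact: wins.
Qed.

Lemma alpha_winning_sub al T T' : T `<=` T' ->
  alpha_winning_on K al T -> alpha_winning_on K al T'.
Proof.
move=> TT' win be be0 be1; have [sigma Hs] := win be be0 be1.
exists sigma => B; have [legal wins] := Hs B; split=> // bob.
exact: subset_trans (wins bob) TT'.
Qed.

Lemma find_mkseq (X : Type) (p : pred X) (B : nat -> X) n k0 :
  p (B k0) -> (forall j, (j < k0)%N -> ~~ p (B j)) -> (k0 <= n)%N ->
  find p (mkseq B n.+1) = k0.
Proof.
move=> pk nk kn; have x0 := B 0%N.
have hp : has p (mkseq B n.+1).
  by apply/(has_nthP x0); exists k0; rewrite ?size_mkseq ?nth_mkseq.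
apply/eqP; rewrite eqn_leq; apply/andP; split; rewrite leqNgt; apply/negP => lt.
  by have := before_find x0 lt; rewrite nth_mkseq ?pk // ltnS.
have := nth_find x0 hp; rewrite nth_mkseq; first by rewrite (negbTE (nk _ lt)).
by rewrite -{2}(size_mkseq B n.+1) -has_find.
Qed.

(** Alice plays trivially until the ball of Bob is one from which she has a
    memoryless winning strategy.  If this never happens, the balls shrink to a
    point without the local property, which is then in [T] already. *)
Lemma delayed_win al be T : 0 < al -> al < 1 -> 0 < be -> be < 1 ->
  (forall x, ~ T x -> exists2 rho : R, 0 < rho & forall C : gball R d, K C.1 -> 0 < C.2 ->
     C.2 <= rho -> gball_set C x -> positional_win K al be T C) ->
  ab_winning_on K al be T.
Proof.
move=> al0 al1 be0 be1 H.
pose good C := `[< positional_win K al be T C >].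
pose x0 : gball R d := (0, 0).
pose trivial_move (B : gball R d) : gball R d := (B.1, al * B.2).
pose legal phi := forall B : gball R d, K B.1 -> 0 < B.2 ->
     [/\ K (phi B).1, (phi B).2 = al * B.2 & gball_set (phi B) `<=` gball_set B].
have triv_legal : legal trivial_move.
  move=> B KB B0; split=> //; apply: eball_sub.
  by rewrite subrr enorm0 add0r /= ger_pMl // ltW.
have /choice[phi Hphi] : forall C : gball R d, exists phi : gball R d -> gball R d,
    legal phi /\ (good C -> forall B : nat -> gball R d, B 0%N = C ->
      (forall k, K (B k).1 /\ 0 < (B k).2) ->
      (forall k, (B k.+1).2 = be * (phi (B k)).2 /\
               gball_set (B k.+1) `<=` gball_set (phi (B k))) ->
      \bigcap_n gball_set (B n) `<=` T).
  move=> C; have [/asboolP[phi [l w]]|ng] := boolP (good C); first by exists phi.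
  by exists trivial_move.
pose move_of (h : seq (gball R d)) :=
  if has good h then phi (nth x0 h (find good h)) else trivial_move.
pose sigma : strategy R d := fun h => move_of h (last x0 h).
have lastE B n : last x0 (mkseq B n.+1) = B n by rewrite -nth_last size_mkseq nth_mkseq.
exists sigma => B.
have alice n : bob_legal_upto K be sigma B n -> alice_legal_at K al sigma B n.
  elim/ltn_ind: n => n IH bob.
  have [KB B0] : K (B n).1 /\ 0 < (B n).2.
    apply: (play_pos al0 be0 bob) => m mn; apply: IH => //.
    exact: bob_legal_upto_le (ltnW mn) bob.
  rewrite /alice_legal_at /alice_ball /sigma lastE /move_of.
  case: ifP => _; last exact: triv_legal.
  by have [l _] := Hphi (nth x0 (mkseq B n.+1) (find good (mkseq B n.+1))); exact: l.
split=> // bob x xB; apply: contrapT => nTx; have [rho rho0 goodC] := H x nTx.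
have ex : exists n, good (B n).
  have [n Bn] := play_radius_small al0 al1 be0 be1 bob alice rho0.
  have [KB B0] := play_center al0 be0 bob alice n.
  by exists n; apply/asboolP; apply: goodC => //; [exact: ltW|exact: xB].
have [k0 gk0 kmin] := ex_minnP ex.
apply: nTx; have [_ /(_ gk0 (fun n => B (k0 + n)%N)) w] := Hphi (B k0).
apply: w => [|k|k|n _]; last exact: (xB (k0 + n)%N).
- by rewrite addn0.
- exact: (play_center al0 be0 bob alice).
have [_ _ /(_ (k0 + k)%N (ltnSn _))] := bob (k0 + k).+1.
rewrite /alice_ball /sigma lastE /move_of addnS.
have -> : has good (mkseq B (k0 + k).+1).
  apply/(has_nthP x0); exists k0; rewrite ?size_mkseq ?nth_mkseq // ltnS leq_addr //.
rewrite (find_mkseq gk0) ?leq_addr //; last first.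
  by move=> j jk; apply/negP => /kmin; rewrite leqNgt jk.
by rewrite nth_mkseq ?ltnS ?leq_addr // => -[_ -> s].
Qed.

(** The moves [(2 ^ i * (2 * k + 1)).-1], [k : nat], are devoted to the [i]-th
    set.  Between two of them the radius shrinks by a fixed factor, so that
    they form a play of the game with another parameter for Bob. *)
Lemma alpha_winning_bigcap al (T : nat -> set 'cV[R]_d) : 0 < al -> al < 1 ->
  (forall i, alpha_winning_on K al (T i)) -> alpha_winning_on K al (\bigcap_i T i).
Proof.
move=> al0 al1 win be be0 be1.
have ab0 : 0 < al * be by rewrite mulr_gt0.
have ab1 : al * be < 1 by rewrite mulr_ilt1 // ltW.
pose bi i : R := be * (al * be) ^+ (2 ^ i.+1).-1.
have bi0 i : 0 < bi i by rewrite mulr_gt0 // exprn_gt0.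
have bi1 i : bi i < 1.
  by apply: le_lt_trans be1; rewrite ger_pMr // exprn_ile1 // ltW.
have /choice[sg Hsg] : forall i, exists s : strategy R d, forall B : nat -> gball R d,
  (forall n, bob_legal_upto K (bi i) s B n -> alice_legal_at K al s B n) /\
    ((forall n, bob_legal_upto K (bi i) s B n) -> \bigcap_n gball_set (B n) `<=` T i).
  by move=> i; exact: win.
pose idx i k := (2 ^ i * k.*2.+1).-1.
have idxS i k : (idx i k).+1 = (2 ^ i * k.*2.+1)%N by rewrite prednK // muln_gt0 expn_gt0.
pose ni n := logn 2 n.+1.
pose nk n := (n.+1 %/ 2 ^ ni n)./2.
have ni_idx i k : ni (idx i k) = i.
  rewrite /ni idxS lognM ?expn_gt0 // pfactorK // [X in (_ + X)%N](_ : _ = 0%N) ?addn0 //.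
  by rewrite lognE /= dvdn2 /= odd_double.
have nk_idx i k : nk (idx i k) = k.
  by rewrite /nk ni_idx idxS mulKn ?expn_gt0 // -[k.*2.+1]add1n halfD odd_double /= doubleK.
have idx_n n : idx (ni n) (nk n) = n.
  have [m m2 E] := pfactor_coprime (isT : prime 2) (ltn0Sn n).
  have odd_m : odd m by rewrite -coprime2n.
  rewrite /idx /nk /ni {2}E mulnK ?expn_gt0 //.
  have -> : (m./2).*2.+1 = m by rewrite -[RHS]odd_double_half odd_m.
  by rewrite mulnC -E.
have idx_mono i k : (idx i k.+1 = idx i k + 2 ^ i.+1)%N.
  by apply: succn_inj; rewrite idxS -addSn idxS doubleS expnS; lia.
have idx_le i k l : (l <= k)%N -> (idx i l <= idx i k)%N.
  by move=> lk; rewrite -ltnS !idxS leq_mul2l ltnS leq_double lk orbT.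
pose x0 : gball R d := (0, 0).
pose sigma : strategy R d := fun h => let n := (size h).-1 in
  sg (ni n) (mkseq (fun l => nth x0 h (idx (ni n) l)) (nk n).+1).
have sE (B : nat -> gball R d) i k :
    alice_ball sigma B (idx i k) = alice_ball (sg i) (fun l => B (idx i l)) k.
  rewrite /alice_ball /sigma size_mkseq /= ni_idx nk_idx; congr (sg i _).
  apply/eq_in_map => l; rewrite mem_iota add0n => /andP[_ lk].
  by rewrite nth_mkseq // ltnS idx_le.
exists sigma => B.
have sub i k : bob_legal_upto K be sigma B (idx i k) ->
    (forall m, (m < idx i k)%N -> alice_legal_at K al sigma B m) ->
    bob_legal_upto K (bi i) (sg i) (fun l => B (idx i l)) k.
  move=> bob alice.
  have pos m : (m <= idx i k)%N -> K (B m).1 /\ 0 < (B m).2.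
    move=> mk; apply: (play_pos al0 be0 (bob_legal_upto_le mk bob)) => m' m'm.
    by apply: alice; exact: leq_trans m'm mk.
  have [K0 B0] := pos _ (idx_le i _ _ (leq0n k)); split=> // l lk.
  have [K1 _] := pos _ (idx_le i _ _ lk).
  rewrite -sE; set m := idx i l.
  have p0 : (0 < 2 ^ i.+1)%N by rewrite expn_gt0.
  have E : idx i l.+1 = (m.+1 + (2 ^ i.+1).-1)%N by rewrite idx_mono -/m; lia.
  have mk : (m < idx i k)%N by apply: leq_trans (idx_le i _ _ lk); rewrite E; lia.
  have [_ _ /(_ m mk)[_ e1 s1]] := bob.
  have [|e2 s2] := play_steps bob alice (m := m.+1) (t := (2 ^ i.+1).-1).
    by rewrite -E; exact: idx_le.
  split; first exact: K1.
  - by rewrite E e2 e1 mulrA (mulrC _ be).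
  - by rewrite E; exact: subset_trans s2 s1.
have alice n : bob_legal_upto K be sigma B n -> alice_legal_at K al sigma B n.
  elim/ltn_ind: n => n IH bob.
  have alice m : (m < n)%N -> alice_legal_at K al sigma B m.
    by move=> mn; apply: IH => //; exact: bob_legal_upto_le (ltnW mn) bob.
  rewrite -(idx_n n) in bob alice *.
  have [/(_ _ (sub _ _ bob alice)) l _] := Hsg (ni n) (fun l => B (idx (ni n) l)).
  by rewrite /alice_legal_at sE.
split=> // bob x xB i _.
have [_ w] := Hsg i (fun l => B (idx i l)); apply: w.
  by move=> n; apply: sub => // m _; exact: (alice _ (bob _)).
by move=> n _; exact: xB.
Qed.

End Game.

(** * The preimages of the badly approximable vectors are winning *)

Lemma positional_win_sub (R : realType) (d : nat) (K : set 'cV[R]_d) (al be : R)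
    (T T' : set 'cV[R]_d) C : T `<=` T' ->
  positional_win K al be T C -> positional_win K al be T' C.
Proof.
move=> TT' [phi [legal w]]; exists phi; split=> // B BC KB Bphi.
exact: subset_trans (w B BC KB Bphi) TT'.
Qed.

(** Around a point of [U], [f i] is as close as desired to its derivative, and
    [escapes_positional] applies to small balls.  The ratio [al] depends on [K]
    only, which is what the intersection over [i] requires. *)
Lemma preimages_winning (R : realType) (M N : nat) (hM : (1 <= M)%N) (hN : (1 <= N)%N)
    (A : 'M[R]_(M, N)) (K : set 'cV[R]_M) : hyperplane_diffuse K ->
  exists al : R, [/\ 0 < al, al < 1 &
    forall (U : set 'cV[R]_M) (f : nat -> 'cV[R]_M -> 'cV[R]_M),
      open U -> (forall i, C1_diffeo_on U (f i)) ->
      alpha_winning_on K al (preimages_on K U (Bad A) f `|` (K `\` U))].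
Proof.
move=> hK; have cK := hK.1.
have [be [rK [be0 be1 rK0 diffuse]]] := diffuse_direction hK.
have [y [ysize ybad]] := bad_of_sequence hM hN A.
pose Y j : 'cV[R]_M := map_mx intr (y j).
have al0 : 0 < be / 16 by rewrite divr_gt0.
have al1 : be / 16 < 1 by lra.
have Y0 j : Y j != 0 -> y j != 0 by apply: contra_neq => e; rewrite /Y e map_mx0.
have Yn j : y j != 0 -> Y j != 0.
  apply: contra_neq => /matrixP e; apply/matrixP => i k.
  by have := e i k; rewrite !mxE => /eqP; rewrite intr_eq0 => /eqP.
have Ylow j : Y j != 0 -> 2 ^+ j / 2 <= enorm (Y j).
  by move/Y0; have [->|[]//] := ysize j; rewrite eqxx.
have Yup j : enorm (Y j) <= M%:R * 2 ^+ j.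
  have [e|[]//] := ysize j; rewrite /Y e map_mx0 enorm0.
  by rewrite mulr_ge0 // exprn_ge0.
exists (be / 16); split=> // U f oU fC1.
pose T i := [set x | U x -> Bad A (f i x)].
suff win : alpha_winning_on K (be / 16) (K `&` \bigcap_i T i).
  apply: alpha_winning_sub win => x [Kx Tx].
  have [Ux|nUx] := pselect (U x); last by right.
  by left; split=> // i _; split=> //; exact: (Tx i I).
apply: alpha_winning_closed => //; apply: alpha_winning_bigcap => // i be' b0 b1.
apply: delayed_win => // x nTx.
have Ux : U x by apply: contrapT => nUx; apply: nTx => /nUx.
have [D [c [c0 Dc strict]]] := diffeo_strict oU (fC1 i) Ux.
have [|rho [rho0 rU fD]] := strict (be / 16 * c); first exact: mulr_gt0.
have [CD CD0 HCD] := enorm_mulmx_le D.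
exists (Num.min (rho / 2) rK); first by rewrite lt_min rK0 divr_gt0.
move=> C KC C0; rewrite le_min => /andP[Cr CrK] Cx.
have CW : gball_set C `<=` eball x rho.
  apply: eball_sub; rewrite enormB; move: Cx; rewrite /gball_set /eball /=.
  lra.
apply: (@positional_win_sub _ _ _ _ _ (escapes Y (f i))).
  move=> z [e e0 ez] Uz; apply: (ybad _ e e0) => j n /Yn Yj; exact: ez.
have L0 : 0 <= CD + be / 16 * c by rewrite addr_ge0 ?mulr_ge0 // ltW.
have fL (z z' : 'cV[R]_M) : eball x rho z -> eball x rho z' ->
    enorm (f i z - f i z') <= (CD + be / 16 * c) * enorm (z - z').
  move=> Wz Wz'; have := enormD (f i z - f i z' - D *m (z - z')) (D *m (z - z')).
  rewrite subrK => /le_trans; apply; rewrite addrC mulrDl lerD //; exact: fD.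
exact: (escapes_positional be0 be1 diffuse (ler0n _ M) Ylow Yup c0 Dc fD L0 fL).
Qed.

(** * Lower bounds for the Hausdorff dimension of winning sets *)

Section WordAvoidance.
Variables (R : realType) (N : nat).
Hypothesis N1 : (1 < N)%N.

Let mass (n : nat) : R := (N%:R ^+ n)^-1.

Lemma word_mass_gt0 n : 0 < mass n.
Proof. by rewrite invr_gt0 exprn_gt0 // ltr0n ltnW. Qed.

(** Countably many cylinders of total mass less than [1] do not cover the space
    of infinite words: among the children of a node in which the listed
    cylinders have relative mass at most [q], some child has the same property,
    and a node with this property is not itself in the list. *)
Lemma avoid_words (w : nat -> seq 'I_N) (q : R) : q < 1 ->
  (forall m, \sum_(i < m) mass (size (w i)) <= q) ->
  exists om : nat -> 'I_N, forall i, mkseq om (size (w i)) != w i.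
Proof.
move=> q1 wq.
pose g v m := \sum_(i < m | prefix v (w i)) mass (size (w i)).
pose good v := forall m, g v m <= q * mass (size v).
have g_mono v m m' : (m <= m')%N -> g v m <= g v m'.
  move=> mm'; rewrite /g -!(big_mkord (fun i => prefix v (w i)) (fun i => mass (size (w i)))).
  rewrite [leRHS](big_cat_nat (leq0n m) mm') /= lerDl.
  by apply: sumr_ge0 => i _; exact/ltW/word_mass_gt0.
have g_split v m : \sum_c g (rcons v c) m <= g v m.
  rewrite /g; under eq_bigr do rewrite big_mkcond.
  rewrite exchange_big /= [leRHS]big_mkcond; apply: ler_sum => i _.
  have [/existsP[c pc]|/existsPn nc] := boolP [exists c, prefix (rcons v c) (w i)].
    have /prefixP[s ws] := pc.
    rewrite (bigD1 c) //= pc big1 ?addr0 => [|c' c'c].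
      by rewrite ws cat_rcons prefix_prefix.
    case: ifP => // /prefixP[s']; rewrite ws !cat_rcons => /eqP.
    by rewrite eqseq_cat // eqxx /= => /eqP[cc']; rewrite cc' eqxx in c'c.
  rewrite big1 => [|c _]; last by rewrite (negbTE (nc c)).
  by case: ifP => // _; exact/ltW/word_mass_gt0.
have child v : good v -> exists c, good (rcons v c).
  move=> gv; apply: contrapT => /forallNP bad.
  have /choice[mc Hmc] : forall c, exists m, q * mass (size (rcons v c)) < g (rcons v c) m.
    by move=> c; have /existsNP[m /negP] := bad c; rewrite -ltNge => lt; exists m.
  pose m := \max_c mc c.
  have := le_trans (g_split v m) (gv m); rewrite leNgt => /negP; apply.
  have -> : q * mass (size v) = \sum_(c < N) (q * mass (size v).+1).
    rewrite sumr_const card_ord -mulr_natl mulrCA; congr (_ * _).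
    by rewrite /mass exprS invfM mulrA mulfV ?mul1r // pnatr_eq0 -lt0n ltnW.
  apply: ltr_sum => [|c _].
    by apply/hasP; exists (Ordinal (ltnW N1)); rewrite ?mem_index_enum.
  have := Hmc c; rewrite size_rcons => /lt_le_trans; apply; apply: g_mono.
  exact: leq_bigmax.
have /choice[next Hnext] : forall v, exists c, good v -> good (rcons v c).
  move=> v; have [/child[c gc]|nv] := pselect (good v); first by exists c.
  by exists (Ordinal (ltnW N1)).
pose node := fix node k := if k is k'.+1 then rcons (node k') (next (node k')) else [::].
pose om k := next (node k).
have nodeE k : mkseq om k = node k by elim: k => // k IH; rewrite mkseqS IH.
have node_good k : good (node k).
  elim: k => [|k IH]; last exact: Hnext.
  move=> m; rewrite /mass expr0 invr1 mulr1; apply: le_trans (wq m).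
  by rewrite /g (eq_bigl predT) // => i; rewrite prefix0s.
exists om => i; apply/negP => /eqP e.
have := node_good (size (w i)) i.+1; rewrite -nodeE e leNgt => /negP; apply.
rewrite /g (bigD1 ord_max) ?prefix_refl //=.
apply: (@lt_le_trans _ _ (mass (size (w i)))).
  by rewrite gtr_pMl // word_mass_gt0.
by rewrite lerDl; apply: sumr_ge0 => k _; exact/ltW/word_mass_gt0.
Qed.
End WordAvoidance.

Lemma ediam_ge (R : realType) (d : nat) (F : set 'cV[R]_d) x y : F x -> F y ->
  ((enorm (x - y))%:E <= ediam F)%E.
Proof. by move=> Fx Fy; apply: ereal_sup_ubound; exists x => //; exists y. Qed.

Lemma ediam_fin (R : realType) (d : nat) (F : set 'cV[R]_d) x (e : R) : F x ->
  (ediam F <= e%:E)%E -> exists D : R, [/\ ediam F = D%:E, 0 <= D & D <= e].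
Proof.
move=> Fx Fe; have := ediam_ge Fx Fx; rewrite subrr enorm0.
by case: (ediam F) Fe => [D| |] //; rewrite !lee_fin => ? ?; exists D.
Qed.

Lemma hausdorff_gauge_ge0 (R : realType) (d : nat) (t : R) (F : set 'cV[R]_d) :
  (0 <= hausdorff_gauge t F)%E.
Proof. by rewrite /hausdorff_gauge; case: ifP => // _; exact: poweR_ge0. Qed.

(** A set of diameter [D] only contains points whose words share their first [n]
    letters, where [n] is the last index with [D < lam ^+ n * r], and the mass
    of this cylinder is at most a multiple of [D `^ s].  So an efficient cover
    would give a list of cylinders of small mass, and miss a point. *)
Lemma dim_ge_tree (R : realType) (d N : nat) (E : set 'cV[R]_d)
    (X : (nat -> 'I_N) -> 'cV[R]_d) (lam r s : R) :
  (1 < N)%N -> 0 < lam -> lam < 1 -> 0 < r -> 0 < s -> 1 <= N%:R * lam `^ s ->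
  (forall om, E (X om)) ->
  (forall om om' k, mkseq om k = mkseq om' k -> om k <> om' k ->
     lam ^+ k.+1 * r <= enorm (X om - X om')) ->
  (s%:E <= hausdorff_dim E)%E.
Proof.
move=> N1 lam0 lam1 r0 s0 Ns EX sep.
have N0 : 0 < N%:R :> R by rewrite ltr0n ltnW.
pose del := Num.min 1 (lam * r).
have del0 : 0 < del by rewrite lt_min ltr01 mulr_gt0.
pose c := r `^ s / (4 * N%:R).
have rs0 : 0 < r `^ s by rewrite powR_gt0.
have c0 : 0 < c by rewrite divr_gt0 // mulr_gt0.
have lamk k l : (k <= l)%N -> lam ^+ l * r <= lam ^+ k * r.
  by move=> kl; rewrite ler_wpM2r ?(ltW r0) // ler_wiXn2l // ltW.
suff content t : 0 <= t -> t <= s -> (c%:E <= hausdorff_content t del E)%E.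
  apply: le_ereal_inf_tmp => _ [t [t0 Ht] <-]; rewrite lee_fin leNgt; apply/negP => ts.
  have : (hausdorff_content t del E <= hausdorff_measure t E)%E.
    by apply: ereal_sup_ubound; exists del.
  rewrite Ht leNgt => /negP; apply; apply: lt_le_trans (content t t0 (ltW ts)).
  by rewrite lte_fin.
move=> t0 ts; apply: le_ereal_inf_tmp => _ [F [EF Fdel] <-].
rewrite leNgt; apply/negP => small.
(* a cylinder containing all the indices of points in [F i]; the term
   [(2 ^+ i.+2)^-1] pays for the sets of diameter [0] *)
have /choice[w Hw] : forall i, exists w : seq 'I_N,
  (((N%:R ^+ size w)^-1)%:E <= (N%:R / r `^ s)%:E * hausdorff_gauge t (F i) +
     ((2 ^+ i.+2)^-1)%:E)%E /\ forall om, F i (X om) -> mkseq om (size w) = w.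
  move=> i.
  have Nr0 : 0 <= N%:R / r `^ s by rewrite divr_ge0 // ltW.
  have N2 : (((N%:R ^+ i.+2)^-1)%:E <= (N%:R / r `^ s)%:E * hausdorff_gauge t (F i) +
     ((2 ^+ i.+2)^-1)%:E :> \bar R)%E.
    apply: (@le_trans _ _ ((2 ^+ i.+2)^-1)%:E).
      rewrite lee_fin lef_pV2 ?posrE ?exprn_gt0 // lerXn2r ?nnegrE ?(ltW N0) //.
      by rewrite ler_nat.
    by rewrite leeDr // mule_ge0 ?hausdorff_gauge_ge0 // lee_fin.
  have [[om0 Fom0]|none] := pselect (exists om, F i (X om)); last first.
    exists (nseq i.+2 (Ordinal (ltnW N1))); rewrite size_nseq; split=> // om Fom.
    by case: none; exists om.
  have [D [DE D0 Ddel]] := ediam_fin Fom0 (Fdel i).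
  have Fn0 : F i != set0 by apply/set0P; exists (X om0).
  have agree n om : D < lam ^+ n * r -> F i (X om) -> mkseq om n = mkseq om0 n.
    move=> Dn Fom; have dist : enorm (X om - X om0) <= D.
      by rewrite -lee_fin -DE; exact: ediam_ge.
    have all_k k : (k <= n)%N -> mkseq om k = mkseq om0 k.
      elim: k => // k IH kn; rewrite !mkseqS IH 1?ltnW //; congr rcons.
      apply: contrapT => ne; have := sep _ _ _ (IH (ltnW kn)) ne.
      rewrite leNgt => /negP; apply; apply: le_lt_trans dist _.
      by apply: lt_le_trans Dn _; exact: lamk.
    exact: all_k.
  have [D00|Dn0] := eqVneq D 0.
    exists (mkseq om0 i.+2); rewrite size_mkseq; split=> // om.
    by apply: agree; rewrite D00 mulr_gt0 // exprn_gt0.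
  have Dp : 0 < D by rewrite lt_neqAle eq_sym Dn0.
  have ex : exists k, lam ^+ k * r <= D.
    have lamc : lam ^+ k @[k --> \oo] --> (0 : R).
      by apply: cvg_expr; rewrite ger0_norm // ltW.
    have Dr : 0 < D / r by rewrite divr_gt0.
    move/cvgrPdist_lt: lamc => /(_ _ Dr)[k _ /(_ k (leqnn k))] /=.
    rewrite sub0r normrN ger0_norm ?exprn_ge0 ?(ltW lam0) // => lt; exists k.
    by rewrite -ler_pdivlMr // ltW.
  have [k kP kmin] := ex_minnP ex; case: k kP kmin => [|n] kP kmin.
    move: (le_trans kP Ddel); rewrite expr0 mul1r le_min => /andP[_].
    by rewrite leNgt gtr_pMl // lam1.
  have Dn : D < lam ^+ n * r.
    by rewrite ltNge; apply/negP => /kmin; rewrite ltnn.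
  exists (mkseq om0 n); rewrite size_mkseq; split; last by move=> om; exact: agree.
  rewrite /hausdorff_gauge (negbTE Fn0) DE poweR_EFin -EFinM -EFinD lee_fin.
  apply: (@le_trans _ _ (N%:R / r `^ s * D `^ t)); last first.
    by rewrite lerDl invr_ge0 exprn_ge0.
  have D1 : D <= 1 by rewrite (le_trans Ddel) // ge_min lexx.
  apply: (@le_trans _ _ (N%:R / r `^ s * D `^ s)); last first.
    by rewrite ler_wpM2l // ger_powR // Dp.
  have Ds : (lam `^ s) ^+ n.+1 * r `^ s <= D `^ s.
    have -> : (lam `^ s) ^+ n.+1 = (lam ^+ n.+1) `^ s.
      rewrite -(powR_mulrn n.+1 (powR_ge0 lam s)) -(powR_mulrn n.+1 (ltW lam0)).
      exact: powRAC.
    rewrite -powRM ?exprn_ge0 ?(ltW lam0) ?(ltW r0) //.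
    apply: (ge0_ler_powR (ltW s0) _ _ kP); rewrite nnegrE ?(ltW Dp) //.
    by rewrite mulr_ge0 ?exprn_ge0 ?(ltW r0) // ltW.
  have Nl : (N%:R ^+ n.+1)^-1 <= (lam `^ s) ^+ n.+1.
    rewrite -exprVn lerXn2r ?nnegrE ?invr_ge0 ?powR_ge0 ?(ltW N0) //.
    by rewrite -[leLHS]mulr1 ler_pdivrMl.
  rewrite mulrAC ler_pdivlMr // -ler_pdivrMl //.
  apply: le_trans Ds; rewrite mulrA ler_wpM2r ?(ltW rs0) //.
  by apply: le_trans Nl; rewrite exprS invfM.
have [|m|om Hom] := @avoid_words R N N1 w (3 / 4).
- by lra.
- have sumF : ((\sum_(i < m) (N%:R ^+ size (w i))^-1)%:E <=
     (N%:R / r `^ s)%:E * (\sum_(i < m) hausdorff_gauge t (F i)) +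
     (\sum_(i < m) (2 ^+ i.+2)^-1)%:E)%E.
    rewrite -!sumEFin ge0_sume_distrr => [|i _]; last exact: hausdorff_gauge_ge0.
    by rewrite -big_split; apply: lee_sum => i _; have [] := Hw i.
  have half : \sum_(i < m) (2 ^+ i.+2)^-1 <= 1 / 2 :> R.
    suff : \sum_(i < m) (2 ^+ i.+2)^-1 = 1 / 2 - (2 ^+ m.+1)^-1 :> R.
      by move=> ->; rewrite gerBl invr_ge0 exprn_ge0.
    elim: m {sumF} => [|m IH]; first by rewrite big_ord0 expr1; lra.
    rewrite big_ord_recr /= IH [2 ^+ m.+2]exprS invfM.
    by set x := (2 ^+ m.+1)^-1; lra.
  have part : (\sum_(i < m) hausdorff_gauge t (F i) <= c%:E)%E.
    apply: le_trans (ltW small).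
    rewrite -(big_mkord predT (fun i => hausdorff_gauge t (F i))).
    by apply: nneseries_lim_ge => i _ _; exact: hausdorff_gauge_ge0.
  rewrite -lee_fin; apply: le_trans sumF _.
  apply: (@le_trans _ _ ((N%:R / r `^ s)%:E * c%:E + (1 / 2)%:E)%E).
    by rewrite leeD ?lee_fin // lee_wpmul2l // lee_fin divr_ge0 // ltW.
  rewrite -EFinM -EFinD lee_fin /c.
  have -> : N%:R / r `^ s * (r `^ s / (4 * N%:R)) = 1 / 4 by field; rewrite !gt_eqF.
  lra.
have [i _ FX] := EF _ (EX om).
have [_ /(_ _ FX) e] := Hw i.
by have := Hom i; rewrite e eqxx.
Qed.

Lemma nested_balls (R : realType) (d : nat) (B : nat -> gball R d) :
  (forall n, 0 <= (B n).2) -> (forall n, gball_set (B n.+1) `<=` gball_set (B n)) ->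
  (forall e : R, 0 < e -> exists n, (B n).2 < e) ->
  exists x, (\bigcap_n gball_set (B n)) x.
Proof.
move=> B0 Bsub Bsmall.
have nest n m : (n <= m)%N -> gball_set (B m) `<=` gball_set (B n).
  elim: m => [|m IH]; first by rewrite leqn0 => /eqP ->.
  rewrite leq_eqVlt => /orP[/eqP -> //|nm].
  by apply: subset_trans (Bsub m) _; apply: IH; rewrite -ltnS.
have cen n m : (n <= m)%N -> enorm ((B m).1 - (B n).1) <= (B n).2.
  by move=> nm; apply: (nest n m nm); exact: eball_center.
have : cauchy ((B n).1 @[n --> \oo]).
  apply: cauchy_exP => e e0; have [n Bn] := Bsmall e e0.
  exists (B n).1; exists n => // m /= nm; rewrite -ball_normE /=.
  rewrite (le_lt_trans (mxnorm_le_enorm _)) // enormB (le_lt_trans _ Bn) //.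
  exact: cen.
move=> /cauchy_cvgP /cvg_ex[x cx]; exists x => n _.
apply: (@closed_cvg _ _ \oo _ (fun m => (B m).1) (gball_set (B n))) cx.
  exact: closed_eball.
by exists n => // m /= nm; exact: cen.
Qed.

(** Bob has [N] answers to each move of Alice, and his plays form a tree all of
    whose branches end in the winning set.  The centers of the answers, balls of
    radius [be * r], are [3 * be * r] apart, so that points in different
    answers remain at distance at least [be * r]. *)
Lemma winning_dim_ge (R : realType) (d : nat) (K T : set 'cV[R]_d) (al be s : R) (N : nat)
    (B0 : gball R d) : 0 < al -> al < 1 -> 0 < be -> be < 1 ->
  ab_winning_on K al be T -> K B0.1 -> 0 < B0.2 -> (1 < N)%N -> 0 < s ->
  1 <= N%:R * (al * be) `^ s ->
  (forall a (r : R), K a -> 0 < r -> r <= B0.2 -> exists p : 'I_N -> 'cV[R]_d,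
     (forall i, K (p i) /\ enorm (p i - a) <= (1 - be) * r) /\
     forall i j, i != j -> 3 * be * r <= enorm (p i - p j)) ->
  (s%:E <= hausdorff_dim (T `&` gball_set B0))%E.
Proof.
move=> al0 al1 be0 be1 [sigma Hs] KB0 B00 N1 s0 Ns branch.
pose x0 : gball R d := (0, 0).
have /choice[br Hbr] : forall A : gball R d, exists p : 'I_N -> 'cV[R]_d,
    K A.1 -> 0 < A.2 -> A.2 <= B0.2 ->
    (forall i, K (p i) /\ enorm (p i - A.1) <= (1 - be) * A.2) /\
     forall i j, i != j -> 3 * be * A.2 <= enorm (p i - p j).
  move=> A; have [[KA A0 AB]|nA] := pselect [/\ K A.1, 0 < A.2 & A.2 <= B0.2].
    by have [p Hp] := branch _ _ KA A0 AB; exists p.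
  by exists (fun=> 0) => KA A0 AB; case: nA.
pose nxt (A : gball R d) c : gball R d := (br A c, be * A.2).
pose hist om := fix hist k := if k is k'.+1 then
  rcons (hist k') (nxt (sigma (hist k')) (om k')) else [:: B0].
pose B om n := last x0 (hist om n).
have histE om n : mkseq (B om) n.+1 = hist om n.
  by elim: n => // n IH; rewrite mkseqS IH /= /B /= last_rcons.
have BS om n : B om n.+1 = nxt (alice_ball sigma (B om) n) (om n).
  by rewrite /B /= last_rcons /alice_ball histE.
have alice om n : bob_legal_upto K be sigma (B om) n -> alice_legal_at K al sigma (B om) n.
  by have [l _] := Hs (B om); exact: l.
have abE : al * be < 1 by rewrite mulr_ilt1 // ltW.
have rA om n : bob_legal_upto K be sigma (B om) n ->
    [/\ K (alice_ball sigma (B om) n).1, 0 < (alice_ball sigma (B om) n).2,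
     (alice_ball sigma (B om) n).2 <= B0.2 &
     (alice_ball sigma (B om) n).2 = al * (B om n).2].
  move=> bob; have al_m m : (m < n)%N -> alice_legal_at K al sigma (B om) m.
    by move=> mn; apply: alice; exact: bob_legal_upto_le (ltnW mn) bob.
  have [KB Bp] := play_pos al0 be0 bob al_m.
  have [KA A2 _] := alice _ _ bob; split=> //; rewrite A2 ?mulr_gt0 //.
  have [e _] := play_steps bob al_m (leqnn (0 + n)%N).
  rewrite add0n in e; rewrite e mulrA ler_piMl ?(ltW B00) //.
  by rewrite mulr_ile1 ?exprn_ge0 ?exprn_ile1 ?mulr_ge0 // ltW.
have bob om n : bob_legal_upto K be sigma (B om) n.
  elim: n => [|n IH]; first by split.
  have [KA A0 AB _] := rA _ _ IH; have [h1 _] := Hbr _ KA A0 AB.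
  have [? ? h] := IH; split=> // k; rewrite ltnS leq_eqVlt => /orP[/eqP ->|]; last exact: h.
  have [Kp pA] := h1 (om n); rewrite BS; split=> //.
  by apply: eball_sub; rewrite (le_trans (lerD pA (lexx _))) // -mulrDl subrK mul1r.
have /choice[X HX] : forall om, exists x, (\bigcap_n gball_set (B om n)) x.
  move=> om; apply: nested_balls => [n|n|e e0].
  - by have [_ /ltW] := play_center al0 be0 (bob om) (alice om) n.
  - have [_] := play_step (bob om n.+1) (fun m _ => alice om m (bob om m)) (ltnSn n).
    exact.
  - exact: (play_radius_small al0 al1 be0 be1 (bob om) (alice om)).
apply: (@dim_ge_tree _ _ N _ X (al * be) B0.2 s) => //; first exact: mulr_gt0.
  move=> om; split; last exact: (HX om 0%N I).
  by have [_ w] := Hs (B om); exact: (w (bob om) _ (HX om)).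
move=> om om' k agree ne.
have hE j : (j <= k)%N -> hist om j = hist om' j.
  elim: j => // j IH jk; rewrite /= IH 1?ltnW //.
  have -> // : om j = om' j.
  by have := congr1 (fun s => nth (om 0%N) s j) agree; rewrite !nth_mkseq.
have AE : alice_ball sigma (B om) k = alice_ball sigma (B om') k.
  by rewrite /alice_ball !histE hE.
have [KA A0 AB A2] := rA _ _ (bob om k).
have [_ sepA] := Hbr _ KA A0 AB.
have := HX om k.+1 I; have := HX om' k.+1 I; rewrite !BS -AE.
rewrite /gball_set /eball /=; set A := alice_ball sigma (B om) k in KA A0 AB A2 sepA *.
move=> x1 x2; have := sepA _ _ (introN eqP ne).
have rad : (al * be) ^+ k.+1 * B0.2 = be * A.2.
  rewrite A2 (play_radius (bob om) (alice om)) exprS; rewrite -!mulrA.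
  by rewrite [be * (al * _)]mulrCA.
rewrite rad.
have := enorm_triangle (X om) (br A (om k)) (br A (om' k)).
have := enorm_triangle (X om') (X om) (br A (om' k)).
rewrite (enormB (br A (om k)) (X om)); lra.
Qed.

(** * Ahlfors regular measures *)

Lemma nneseries_le_partial (R : realType) (u : nat -> \bar R) (c : \bar R) :
  (forall n, (0 <= u n)%E) -> (forall m, (\sum_(0 <= j < m) u j <= c)%E) ->
  (\sum_(0 <= j <oo) u j <= c)%E.
Proof.
move=> u0 uc; apply: lime_le; first exact: is_cvg_nneseries.
by apply: nearW => m; exact: uc.
Qed.

Lemma sum_indic_le (R : numDomainType) (c : R) (m n : nat) : 0 <= c ->
  \sum_(0 <= j < m) (if (j < n)%N then c else 0) <= n%:R * c.
Proof.
move=> c0; apply: (@le_trans _ _ (\sum_(0 <= j < n + m) (if (j < n)%N then c else 0))).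
  rewrite [leRHS](@big_cat_nat _ _ _ m) ?leq_addl //= lerDl.
  by apply: sumr_ge0 => j _; case: ifP.
rewrite (@big_cat_nat _ _ _ n) ?leq_addr //= [X in _ + X](_ : _ = 0); last first.
  by rewrite big_nat_cond big1 // => j /andP[/andP[nj _] _]; rewrite ltnNge nj.
rewrite addr0 big_nat_cond (eq_bigr (fun=> c)); last by move=> j /andP[/andP[_ ->]].
by rewrite -big_nat_cond sumr_const_nat subn0 mulr_natl.
Qed.

Lemma hausdorff_content_mono (R : realType) (d : nat) (s del : R) (E E' : set 'cV[R]_d) :
  E `<=` E' -> (hausdorff_content s del E <= hausdorff_content s del E')%E.
Proof.
move=> EE'; apply: ereal_inf_le_tmp => _ [F [EF Fd] <-]; exists F => //; split=> //.
exact: subset_trans EF.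
Qed.

Lemma hausdorff_content_ge0 (R : realType) (d : nat) (s del : R) (E : set 'cV[R]_d) :
  (0 <= hausdorff_content s del E)%E.
Proof.
apply: le_ereal_inf_tmp => _ [F _ <-]; apply: nneseries_ge0 => i _ _.
exact: hausdorff_gauge_ge0.
Qed.

Lemma hausdorff_measure_eq0 (R : realType) (d : nat) (s : R) (E : set 'cV[R]_d) :
  (forall del, 0 < del -> (hausdorff_content s del E <= 0)%E) -> hausdorff_measure s E = 0%E.
Proof.
move=> H; apply/eqP; rewrite eq_le; apply/andP; split.
  by apply: ge_ereal_sup => _ [del /= d0 <-]; exact: H.
apply: le_trans (hausdorff_content_ge0 s 1 E) _.
by apply: ereal_sup_ubound; exists 1 => //=.
Qed.

Lemma hausdorff_dim_mono (R : realType) (d : nat) (E E' : set 'cV[R]_d) :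
  E `<=` E' -> (hausdorff_dim E <= hausdorff_dim E')%E.
Proof.
move=> EE'; apply: ereal_inf_le_tmp => _ [s [s0 Hs] <-]; exists s => //; split=> //.
apply: hausdorff_measure_eq0 => del d0.
apply: le_trans (hausdorff_content_mono _ _ EE') _.
by rewrite -Hs; apply: ereal_sup_ubound; exists del.
Qed.

Lemma hausdorff_dim_ge0 (R : realType) (d : nat) (E : set 'cV[R]_d) :
  (0 <= hausdorff_dim E)%E.
Proof. by apply: le_ereal_inf_tmp => _ [s [s0 _] <-]; rewrite lee_fin. Qed.

(** Covers of the sets [E i] of costs [e / 2 ^ i.+1] are put in one sequence. *)
Lemma hausdorff_content_bigcup (R : realType) (d : nat) (s del : R)
    (E : nat -> set 'cV[R]_d) :
  (forall i (e : R), 0 < e -> exists F : nat -> set 'cV[R]_d,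
    [/\ E i `<=` \bigcup_j F j, forall j, (ediam (F j) <= del%:E)%E &
        (\sum_(0 <= j <oo) hausdorff_gauge s (F j) <= e%:E)%E]) ->
  (hausdorff_content s del (\bigcup_i E i) <= 0)%E.
Proof.
move=> H; apply/lee_addgt0Pr => e e0; rewrite add0e.
have /choice[F HF] : forall i, exists F : nat -> set 'cV[R]_d,
    [/\ E i `<=` \bigcup_j F j, forall j, (ediam (F j) <= del%:E)%E &
        (\sum_(0 <= j <oo) hausdorff_gauge s (F j) <= (e / (2 ^ i.+1)%:R)%:E)%E].
  by move=> i; apply: H; rewrite divr_gt0 // ltr0n expn_gt0.
have /card_esym/ppcard_eqP[f] := card_nat2.
pose G n := F (f n).1 (f n).2.
apply: (@le_trans _ _ (\sum_(0 <= n <oo) hausdorff_gauge s (G n))%E).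
  apply: ereal_inf_lbound; exists G => //; split=> [x [i _ Eix]|n]; last first.
    by have [_ + _] := HF (f n).1; apply.
  have [/(_ x Eix)[j _ Fx] _ _] := HF i.
  by exists (f^-1%FUN (i, j)) => //; rewrite /G invK ?inE.
rewrite nneseries_esumT => [|n]; last exact: hausdorff_gauge_ge0.
rewrite -(@reindex_esum R _ _ setT setT f (fun p => hausdorff_gauge s (F p.1 p.2))); last first.
  exact: (@bij _ _ setT setT f).
rewrite (_ : [set: nat * nat] = [set: nat] `*`` (fun=> [set: nat])); last first.
  by apply/seteqP; split.
rewrite -(@esum_esum R _ _ setT (fun=> setT) (fun i j => hausdorff_gauge s (F i j))); last first.
  by move=> i j _ _; exact: hausdorff_gauge_ge0.
apply: le_trans (epsilon_trick0 predT (ltW e0)).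
rewrite nneseries_esumT => [|n]; last by rewrite lee_fin divr_ge0 // ltW.
apply: le_esum => i _.
rewrite -nneseries_esumT => [|j]; last exact: hausdorff_gauge_ge0.
by have [_ _] := HF i.
Qed.

Section Separated.
Variables (R : realType) (d : nat).
Implicit Types (P : set 'cV[R]_d) (p : nat -> 'cV[R]_d).

Definition separated P (rho : R) n p :=
  (forall i, (i < n)%N -> P (p i)) /\
  forall i j, (i < n)%N -> (j < n)%N -> i != j -> rho <= enorm (p i - p j).

Lemma separatedS P rho n p x : separated P rho n p -> P x ->
  (forall i, (i < n)%N -> rho <= enorm (x - p i)) ->
  separated P rho n.+1 (fun i => if i == n then x else p i).
Proof.
move=> [Pp sp] Px sx; split=> [i|i j].
  by rewrite ltnS leq_eqVlt; case: eqP => // _ /=; exact: Pp.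
rewrite !ltnS (leq_eqVlt i n) (leq_eqVlt j n); case: eqP => [->|_] /=; case: eqP => [->|_] //=.
- by rewrite eqxx.
- by move=> _ jn _; exact: sx.
- by move=> iltn _ _; rewrite enormB; exact: sx.
- exact: sp.
Qed.

Lemma maximal_separated P rho b : (forall n p, separated P rho n p -> (n <= b)%N) ->
  exists n p, separated P rho n p /\
    forall x, P x -> exists2 i, (i < n)%N & enorm (x - p i) < rho.
Proof.
move=> bd; pose Q n := `[< exists p, separated P rho n p >].
have ex : exists n, Q n by exists 0%N; apply/asboolP; exists (fun=> 0); split.
have Qb n : Q n -> (n <= b)%N by move=> /asboolP[p]; exact: bd.
have [n /asboolP[p sp] nmax] := ex_maxnP ex Qb.
exists n, p; split=> // x Px; apply: contrapT => none.
suff : Q n.+1 by move/nmax; rewrite ltnn.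
apply/asboolP; eexists; apply: (separatedS sp Px) => i iltn.
by rewrite leNgt; apply/negP => lt; apply: none; exists i.
Qed.

Lemma greedy_separated P rho N :
  (forall n p, (n < N)%N -> separated P rho n p ->
     exists2 x, P x & forall i, (i < n)%N -> rho <= enorm (x - p i)) ->
  exists p, separated P rho N p.
Proof.
move=> H; suff : forall n, (n <= N)%N -> exists p, separated P rho n p by exact.
elim=> [_|n IH nN]; first by exists (fun=> 0); split.
have [p sp] := IH (ltnW nN); have [x Px sx] := H n p nN sp.
by eexists; exact: separatedS sp Px sx.
Qed.

End Separated.

Lemma rational_near (R : realType) (d : nat) (x : 'cV[R]_d) (e : R) : 0 < e ->
  exists q : 'cV[rat]_d, enorm (x - map_mx ratr q) < e.
Proof.
move=> e0; pose t := e / (d%:R + 1).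
have d1 : 0 < d%:R + 1 :> R by rewrite ltr_wpDl.
have t0 : 0 < t by rewrite divr_gt0.
have /choice[q Hq] : forall i, exists q : rat, `|x i 0 - ratr q| <= t.
  move=> i; have [|q] := @rat_in_itvoo R (x i 0 - t) (x i 0 + t); first by lra.
  rewrite in_itv /= => /andP[h1 h2]; exists q.
  by rewrite ler_norml; apply/andP; split; lra.
exists (\col_i q i); apply: (@le_lt_trans _ _ (d%:R * t)).
  by apply: enorm_le_coord => [|i]; [exact: ltW|rewrite !mxE].
by rewrite /t mulrA ltr_pdivrMr // mulrC ltr_pM2l // ltrDl.
Qed.

Section BorelMeasure.
Variables (R : realType) (d : nat) (mu : {measure set (Rd_borel R d) -> \bar R}).

Lemma measurable_open (V : set 'cV[R]_d) : open V -> measurable (V : set (Rd_borel R d)).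
Proof. by move=> oV; exact: sub_sigma_algebra. Qed.

Lemma measurable_closed (V : set 'cV[R]_d) : closed V -> measurable (V : set (Rd_borel R d)).
Proof.
move=> cV; rewrite -[V]setCK; apply: measurableC; apply: measurable_open.
exact: closed_openC.
Qed.

Lemma measurable_eball x r : measurable (eball x r : set (Rd_borel R d)).
Proof. by apply: measurable_closed; exact: closed_eball. Qed.

Lemma measurable_supportC : measurable (~` msupport mu : set (Rd_borel R d)).
Proof.
apply: measurable_open; rewrite openE => x nx.
have /existsNP[V /not_implyP[oV /not_implyP[Vx nV]]] :
    ~ (forall V : set 'cV[R]_d, open V -> V x -> (0 < mu V)%E) := nx.
apply: (filterS _ (open_nbhs_nbhs (conj oV Vx))).
by move=> y Vy Ky; apply: nV; exact: Ky.
Qed.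

(** The balls with rational centers and radii [1 / k] form a countable base of
    the topology, and the complement of the support is covered by those of
    measure [0]. *)
Lemma mu_supportC : mu (~` msupport mu) = 0%E.
Proof.
pose O (q : 'cV[rat]_d) (k : nat) : set 'cV[R]_d :=
  [set y | enorm (y - map_mx ratr q) < k.+1%:R^-1].
pose A (n : nat) : set 'cV[R]_d := if unpickle n is Some qk then
  (if mu (O qk.1 qk.2) == 0%E then O qk.1 qk.2 else set0) else set0.
have mO q k : measurable (O q k : set (Rd_borel R d)).
  by apply: measurable_open; exact: open_enorm_lt.
have mA n : measurable (A n : set (Rd_borel R d)).
  by rewrite /A; case: unpickle => // -[q k]; case: ifP.
have A0 n : mu (A n) = 0%E.
  rewrite /A; case: unpickle => [[q k]|]; last exact: measure0.
  by case: ifP => [/eqP //|_]; exact: measure0.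
apply/eqP; rewrite eq_le measure_ge0 andbT.
apply: le_trans (measure_sigma_subadditive mu mA measurable_supportC _) _; last first.
  by rewrite eseries0.
move=> x nx; have /existsNP[V /not_implyP[oV /not_implyP[Vx nV]]] :
    ~ (forall V : set 'cV[R]_d, open V -> V x -> (0 < mu V)%E) := nx.
have [rho rho0 rV] := open_eball oV Vx.
pose k := Num.bound (2 / rho).
have k0 : 0 < k.+1%:R :> R by rewrite ltr0n.
have kr : 2 * k.+1%:R^-1 < rho.
  rewrite ltr_pdivrMr // -ltr_pdivrMl // mulrC (lt_trans (archi_boundP _)) //.
    by rewrite divr_ge0 // ltW.
  by rewrite ltr_nat.
have [q Hq] : exists q : 'cV[rat]_d, enorm (x - map_mx ratr q) < k.+1%:R^-1.
  by apply: rational_near; rewrite invr_gt0.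
exists (pickle (q, k)) => //; rewrite /A pickleK /= ifT //.
rewrite eq_le measure_ge0 andbT; apply: le_trans (_ : mu V <= 0)%E.
  apply: le_measure; rewrite ?inE //; first exact: measurable_open.
  move=> y Oy; apply: rV; rewrite /eball /=.
  have := enorm_triangle (map_mx ratr q) y x; rewrite (enormB (map_mx ratr q)).
  rewrite /O /= in Oy; move=> h.
  by apply: le_trans h (ltW (lt_trans (ltrD Oy Hq) _)); rewrite -mulr2n -[ltLHS]mulr_natl.
by rewrite leNgt; apply/negP.
Qed.

(** Balls of radius a third of the separation are disjoint. *)
Lemma separated_balls_count P (rho m c : R) x r n p : separated P rho n p -> 0 < rho ->
  (forall i, (i < n)%N -> (m%:E <= mu (eball (p i) (rho / 3)))%E) ->
  (forall i, (i < n)%N -> eball (p i) (rho / 3) `<=` eball x r) ->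
  (mu (eball x r) <= c%:E)%E -> n%:R * m <= c.
Proof.
move=> [_ sp] rho0 lo sub hi.
pose F (i : nat) : set (Rd_borel R d) := if (i < n)%N then eball (p i) (rho / 3) else set0.
have mF i : measurable (F i) by rewrite /F; case: ifP => // _; exact: measurable_eball.
have tF : trivIset setT F.
  apply/trivIsetP => i j _ _ ij; rewrite /F.
  case: ifP => iltn; last by rewrite set0I.
  case: ifP => jltn; last by rewrite setI0.
  apply/seteqP; split=> // y [/= yi yj]; have := sp i j iltn jltn ij.
  have := enorm_triangle y (p i) (p j); rewrite (enormB (p i) y).
  by rewrite /eball /= in yi yj; move: yi yj; lra.
rewrite -lee_fin; apply: le_trans hi.
have sumE := measure_bigsetU mu mF tF n.
apply: (@le_trans _ _ (mu (\big[setU/set0]_(i < n) F i))).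
  rewrite [leRHS]sumE; apply: (@le_trans _ _ (\sum_(i < n) m%:E)%E).
    by rewrite sumEFin sumr_const card_ord mulr_natl.
  by apply: lee_sum => i _; rewrite /F ltn_ord; exact: lo.
apply: le_measure; rewrite ?inE.
- by apply: bigsetU_measurable.
- exact: measurable_eball.
- rewrite -bigcup_mkord => y [i /= iltn]; rewrite /F iltn; exact: sub.
Qed.

Variable K : set 'cV[R]_d.
Hypothesis muK : msupport mu = K.
Variables (delta k1 k2 rho0 : R).
Hypotheses (k10 : 0 < k1) (k20 : 0 < k2) (rho00 : 0 < rho0).
Hypothesis reg : forall (x : 'cV[R]_d) (rho : R), K x -> 0 < rho -> rho < rho0 ->
  ((k1 * rho `^ delta)%:E <= mu (eball x rho))%E /\
  (mu (eball x rho) <= (k2 * rho `^ delta)%:E)%E.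

(** Comparing measures, a maximal [rho]-separated set in a bounded piece of [K]
    has at most a multiple of [rho `^ (- delta)] points; the balls of radius
    [rho] around them form a cover whose cost is at most a multiple of
    [rho `^ (s - delta)]. *)
Lemma ahlfors_piece x s del e : K x -> 0 <= s -> delta < s -> 0 < del -> 0 < e ->
  exists F : nat -> set 'cV[R]_d,
    [/\ K `&` eball x (rho0 / 4) `<=` \bigcup_j F j, forall j, (ediam (F j) <= del%:E)%E &
        (\sum_(0 <= j <oo) hausdorff_gauge s (F j) <= e%:E)%E].
Proof.
move=> Kx s0 ds del0 e0.
pose C := k2 * (rho0 / 2) `^ delta / (k1 * 3^-1 `^ delta).
have C0 : 0 < C by rewrite divr_gt0 ?mulr_gt0 ?powR_gt0 // divr_gt0.
have C2 : 0 < C * 2 `^ s by rewrite mulr_gt0 ?powR_gt0.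
pose rho := Num.min (Num.min (rho0 / 4) (del / 2)) ((e / (C * 2 `^ s)) `^ (s - delta)^-1).
have rho0' : 0 < rho by rewrite !lt_min !divr_gt0 //= powR_gt0 // divr_gt0.
have rho1 : rho <= rho0 / 4 by rewrite /rho !ge_min lexx.
have rho2 : 2 * rho <= del by rewrite -ler_pdivlMl // mulrC /rho !ge_min lexx orbT.
have rho3 : C * 2 `^ s * rho `^ (s - delta) <= e.
  rewrite -ler_pdivlMl // mulrC.
  have sd : 0 < s - delta by rewrite subr_gt0.
  have E : e / (C * 2 `^ s) = ((e / (C * 2 `^ s)) `^ (s - delta)^-1) `^ (s - delta).
    by rewrite -powRrM mulVf ?gt_eqF // powRr1 // divr_ge0 ?ltW.
  rewrite E; apply: (ge0_ler_powR (ltW sd)); rewrite ?nnegrE ?powR_ge0 ?(ltW rho0') //.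
  by rewrite /rho ge_min lexx orbT.
have rd0 : 0 < rho `^ delta by rewrite powR_gt0.
have count n p : separated (K `&` eball x (rho0 / 4)) rho n p -> n%:R * rho `^ delta <= C.
  move=> sp; have [Pp _] := sp.
  rewrite /C ler_pdivlMr ?mulr_gt0 ?powR_gt0 //.
  have -> : n%:R * rho `^ delta * (k1 * 3^-1 `^ delta) = n%:R * (k1 * (rho / 3) `^ delta).
    by rewrite powRM ?invr_ge0 ?(ltW rho0') //; ring.
  apply: (separated_balls_count sp rho0' (x := x) (r := rho0 / 2)) => [i /Pp[Kp _]|i /Pp[_ xp]|].
  - by have [|//|] := reg Kp (rho := rho / 3); [rewrite divr_gt0|lra|].
  - by apply: eball_sub; rewrite /eball /= in xp; lra.
  - by have [] := reg Kx (rho := rho0 / 2); [rewrite divr_gt0|lra|].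
have [|n [p [sp cov]]] := @maximal_separated R d (K `&` eball x (rho0 / 4)) rho
    (Num.bound (C / rho `^ delta)).
  move=> n p /count; rewrite -ler_pdivlMr // => h.
  by rewrite -(ler_nat R) (le_trans h) // ltW // archi_boundP // divr_ge0 // ltW.
pose F (j : nat) : set 'cV[R]_d := if (j < n)%N then eball (p j) rho else set0.
have diamF j : (ediam (F j) <= (2 * rho)%:E)%E.
  apply: ge_ereal_sup => _ [y Fy [z Fz <-]]; rewrite lee_fin.
  move: Fy Fz; rewrite /F; case: ifP => // _; rewrite /eball /= => yp zp.
  by have := enorm_triangle (p j) y z; rewrite (enormB (p j)); lra.
exists F; split=> [y Py|j|].
- by have [i iltn yi] := cov y Py; exists i; rewrite /F ?iltn //=; exact: ltW.
- by apply: le_trans (diamF j) _; rewrite lee_fin.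
apply: nneseries_le_partial => [j|m]; first exact: hausdorff_gauge_ge0.
have gF j : (hausdorff_gauge s (F j) <= (if (j < n)%N then (2 * rho) `^ s else 0)%:E)%E.
  rewrite /hausdorff_gauge; case: eqP => [_|/eqP/set0P[y Fy]].
    by rewrite lee_fin; case: ifP => // _; exact: powR_ge0.
  have [D [-> D0 D2]] := ediam_fin Fy (diamF j).
  rewrite ifT; last by move: Fy; rewrite /F; case: ifP.
  rewrite poweR_EFin lee_fin; apply: (ge0_ler_powR s0 _ _ D2); rewrite nnegrE //.
  by rewrite mulr_ge0 // ltW.
apply: (@le_trans _ _ (\sum_(0 <= j < m) (if (j < n)%N then (2 * rho) `^ s else 0)%:E)%E).
  by apply: lee_sum => j _; exact: gF.
rewrite sumEFin lee_fin.
apply: (@le_trans _ _ (n%:R * (2 * rho) `^ s)).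
  by apply: sum_indic_le; exact: powR_ge0.
apply: le_trans rho3; have -> : (2 * rho) `^ s = 2 `^ s * (rho `^ delta * rho `^ (s - delta)).
  rewrite powRM ?(ltW rho0') // -powRD; first by rewrite addrC subrK.
  by apply/implyP => _; rewrite gt_eqF.
have -> : n%:R * (2 `^ s * (rho `^ delta * rho `^ (s - delta))) =
   (n%:R * rho `^ delta) * (2 `^ s * rho `^ (s - delta)) by ring.
by rewrite -[leRHS]mulrA ler_wpM2r ?mulr_ge0 ?powR_ge0 //; exact: count sp.
Qed.

Lemma ahlfors_dim_le (s : R) : 0 <= s -> delta < s -> (hausdorff_dim K <= s%:E)%E.
Proof.
move=> s0 ds; apply: ereal_inf_lbound; exists s => //; split=> //.
apply: hausdorff_measure_eq0 => del del0.
have r8 : 0 < rho0 / 8 by rewrite divr_gt0.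
have /choice[x Hx] : forall q : 'cV[rat]_d, exists x, forall y, K y ->
    enorm (y - map_mx ratr q) < rho0 / 8 -> K x /\ eball x (rho0 / 4) y.
  move=> q; have [[x Kx xq]|none] :=
    pselect (exists2 x, K x & enorm (x - map_mx ratr q) < rho0 / 8).
    exists x => y Ky yq; split=> //; rewrite /eball /=.
    by have := enorm_triangle (map_mx ratr q) y x; rewrite (enormB (map_mx ratr q)); lra.
  by exists 0 => y Ky yq; case: none; exists y.
pose E (i : nat) : set 'cV[R]_d := if unpickle i is Some q then
   [set y | [/\ K (x q), K y & eball (x q) (rho0 / 4) y]] else set0.
have KE : K `<=` \bigcup_i E i.
  move=> y Ky; have [q yq] := rational_near y r8.
  by exists (pickle q) => //; rewrite /E pickleK /=; have [] := Hx q y Ky yq.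
apply: le_trans (hausdorff_content_mono _ _ KE) _.
apply: hausdorff_content_bigcup => i e e0; rewrite /E.
have empty : exists F : nat -> set 'cV[R]_d, [/\ set0 `<=` \bigcup_j F j,
    forall j, (ediam (F j) <= del%:E)%E & (\sum_(0 <= j <oo) hausdorff_gauge s (F j) <= e%:E)%E].
  exists (fun=> set0); split=> // [j|].
    by apply: ge_ereal_sup => _ [y []].
  rewrite eseries0 ?lee_fin ?(ltW e0) // => j _ _.
  by rewrite /hausdorff_gauge eqxx.
case: unpickle => [q|//]; have [Kxq|nK] := pselect (K (x q)); last first.
  rewrite (_ : mkset _ = set0) //.
  by apply/seteqP; split=> // y [].
have [F [F1 F2 F3]] := ahlfors_piece Kxq s0 ds del0 e0.
by exists F; split=> // y [_ Ky yx]; apply: F1.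
Qed.

(** When the ball is much larger than the separation, balls around fewer than
    [N] points do not exhaust its measure, and what remains meets the support. *)
Lemma ahlfors_branch (be : R) (N : nat) : 0 < delta -> 0 < be -> be <= 1 / 2 ->
  N%:R <= k1 / (k2 * 6 `^ delta) * be `^ (- delta) ->
  forall a r, K a -> 0 < r -> r < rho0 / 2 -> exists p : 'I_N -> 'cV[R]_d,
     (forall i, K (p i) /\ enorm (p i - a) <= (1 - be) * r) /\
     forall i j, i != j -> 3 * be * r <= enorm (p i - p j).
Proof.
move=> de0 be0 be2 HN a r Ka r0 rr.
have sep0 : 0 < 3 * be * r by rewrite !mulr_gt0.
have [|p [Pp sp]] := @greedy_separated R d (K `&` eball a (r / 2)) (3 * be * r) N.
  move=> n p nN [Pp sp].
  pose F (i : nat) : set (Rd_borel R d) := if (i < n)%N then eball (p i) (3 * be * r) else ~` K.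
  apply: contrapT => none.
  have mF k : measurable (F k).
    rewrite /F; case: ifP => _; first exact: measurable_eball.
    by rewrite -muK; exact: measurable_supportC.
  have cov : eball a (r / 2) `<=` \big[setU/set0]_(k < n.+1) F k.
    move=> y ya; rewrite -bigcup_mkord; apply: contrapT => ny; apply: none.
    have Ky : K y.
      by apply: contrapT => nKy; apply: ny; exists n => //=; rewrite /F ltnn.
    exists y; first by split.
    move=> i iltn; rewrite leNgt; apply/negP => lt; apply: ny; exists i; first by rewrite /= ltnW.
    by rewrite /F iltn /eball /= ltW.
  have hi := content_subadditive mu (fun k _ => mF k) (measurable_eball a (r / 2)) cov.
  have [lo _] : ((k1 * (r / 2) `^ delta)%:E <= mu (eball a (r / 2)))%E /\
      (mu (eball a (r / 2)) <= (k2 * (r / 2) `^ delta)%:E)%E.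
    by apply: reg => //; [rewrite divr_gt0|lra].
  have up : (\sum_(k < n.+1) mu (F k) <= (n%:R * (k2 * (3 * be * r) `^ delta))%:E)%E.
    rewrite big_ord_recr /= [X in (_ + X)%E](_ : _ = 0%E); last first.
      by rewrite /F ltnn -muK; exact: mu_supportC.
    rewrite adde0; apply: (@le_trans _ _ (\sum_(k < n) (k2 * (3 * be * r) `^ delta)%:E)%E).
      apply: lee_sum => k _; rewrite /F /= ltn_ord.
      have [Kp _] := Pp k (ltn_ord k).
      by have [] := reg Kp (rho := 3 * be * r); [|nra|].
    by rewrite sumEFin sumr_const card_ord lee_fin -[leLHS]mulr_natl.
  have := le_trans lo (le_trans hi up); rewrite lee_fin leNgt => /negP; apply.
  have six : 3 * be * r = 6 * be * (r / 2) by field.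
  rewrite six powRM ?mulr_ge0 ?divr_ge0 ?(ltW be0) ?(ltW r0) // powRM ?(ltW be0) //.
  have rd : 0 < (r / 2) `^ delta by rewrite powR_gt0 // divr_gt0.
  rewrite !mulrA ltr_pM2r //.
  have bd : 0 < be `^ delta by rewrite powR_gt0.
  have kd : 0 < k2 * 6 `^ delta by rewrite mulr_gt0 ?powR_gt0.
  have : n%:R < k1 / (k2 * 6 `^ delta) * be `^ (- delta).
    by apply: lt_le_trans HN; rewrite ltr_nat.
  rewrite powRN ltr_pdivlMr // ltr_pdivlMr //; lra.
exists (fun i : 'I_N => p i); split=> [i|i j ij]; last exact: sp.
have [Kp pa] := Pp i (ltn_ord i); split=> //; apply: le_trans pa _.
by rewrite mulrC ler_wpM2r ?(ltW r0) //; lra.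
Qed.

End BorelMeasure.

(** * Dimension of the intersection of the preimages *)

Lemma powR_inv_exponent (R : realType) (a b t : R) : 0 < t -> 0 < a -> 0 <= b ->
  b <= a `^ t^-1 -> b `^ t <= a.
Proof.
move=> t0 a0 b0 le; have -> : a = (a `^ t^-1) `^ t.
  by rewrite -powRrM mulVf ?powRr1 ?gt_eqF // ltW.
by apply: (ge0_ler_powR (ltW t0) _ _ le); rewrite nnegrE ?powR_ge0.
Qed.

Section LocalDimension.
Variables (R : realType) (d : nat) (K U T : set 'cV[R]_d) (al : R).
Hypotheses (oU : open U) (UK : U `&` K !=set0) (al0 : 0 < al) (al1 : al < 1).
Hypothesis TU : T `<=` K `&` U.
Hypothesis win : alpha_winning_on K al (T `|` (K `\` U)).

(** If Bob starts in [U], the play can only end in [T]. *)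
Lemma local_dim_ge (r1 be s : R) (N : nat) : 0 < r1 -> 0 < be -> be < 1 ->
  (1 < N)%N -> 0 < s -> 1 <= N%:R * (al * be) `^ s ->
  (forall a (r : R), K a -> 0 < r -> r < r1 -> exists p : 'I_N -> 'cV[R]_d,
     (forall i, K (p i) /\ enorm (p i - a) <= (1 - be) * r) /\
     forall i j, i != j -> 3 * be * r <= enorm (p i - p j)) ->
  (s%:E <= hausdorff_dim T)%E.
Proof.
move=> r10 be0 be1 N1 s0 Ns branch; have [x0 [Ux0 Kx0]] := UK.
have [rho rho0 rU] := open_eball oU Ux0.
pose B0 : gball R d := (x0, Num.min rho (r1 / 2)).
have B00 : 0 < B0.2 by rewrite lt_min rho0 divr_gt0.
have Br : B0.2 < r1 by rewrite gt_min ltr_pdivrMr // ltr_pMr // ltr1n orbT.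
have := winning_dim_ge al0 al1 be0 be1 (win be0 be1) (B0 := B0) Kx0 B00 N1 s0 Ns.
move=> /(_ (fun a r Ka r0 rB => branch a r Ka r0 (le_lt_trans rB Br))) /le_trans.
apply; apply: hausdorff_dim_mono => x [[//|[_ nUx]] xB]; case: nUx; apply: rU.
by rewrite /gball_set /eball /= in xB *; rewrite (le_trans xB) // ge_min lexx.
Qed.

(** Diffuseness gives two separated answers, [a] itself and a point of [K] far
    from it, and [s] is the solution of [2 * (al * be) `^ s = 1]. *)
Lemma local_dim_gt0 : (0 < d)%N -> hyperplane_diffuse K -> (0 < hausdorff_dim T)%E.
Proof.
move=> d0 /diffuse_direction[bK [rK [bK0 bK1 rK0 diffuse]]].
pose be := bK / 8; have be0 : 0 < be by rewrite divr_gt0.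
have be8 : 8 * be < 1 by rewrite /be mulrC divfK // pnatr_eq0.
have ab0 : 0 < al * be by rewrite mulr_gt0.
have ab1 : al * be < 1 by rewrite mulr_ilt1 ?ltW //; lra.
pose s : R := ln 2 / - ln (al * be).
have l0 : ln (al * be) < 0 by rewrite ln_lt0 // ab0.
have s0 : 0 < s by rewrite divr_gt0 ?oppr_gt0 // ln_gt0 // ltr1n.
have abs : (al * be) `^ s = 2^-1.
  rewrite /powR gt_eqF // /s invrN mulrN mulNr divfK ?lt_eqF // expRN lnK //.
  by rewrite posrE.
apply: (@lt_le_trans _ _ s%:E); first by rewrite lte_fin.
apply: (@local_dim_ge rK be s 2) => //; first by lra.
  by rewrite abs divff // pnatr_eq0.
move=> a r Ka r0 rr.
pose v : 'cV[R]_d := const_mx 1.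
have v0 : v != 0.
  apply/eqP => /matrixP/(_ (Ordinal d0) 0); rewrite !mxE.
  by move/eqP; rewrite oner_eq0.
have br0 : 0 < (1 - be) * r by rewrite mulr_gt0 //; lra.
have [|x [Kx xa vx]] := diffuse _ _ v br0 _ Ka v0.
  by rewrite (le_trans _ (ltW rr)) // ger_pMl //; lra.
have far : 3 * be * r <= enorm (x - a).
  have vp : 0 < enorm v by rewrite enorm_gt0.
  have := le_trans vx (dot_le v (x - a)); rewrite mulrC ler_pM2l //.
  apply: le_trans; have -> : bK = 8 * be by rewrite /be mulrC divfK // pnatr_eq0.
  rewrite -subr_ge0 (_ : _ - _ = be * r * (5 - 8 * be)); last by ring.
  by rewrite mulr_ge0 ?mulr_ge0 ?(ltW be0) ?(ltW r0) //; lra.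
exists (fun i : 'I_2 => if i == ord0 then a else x); split=> [i|i j].
  by case: ifP => _; split=> //; rewrite subrr enorm0 ltW.
case: (eqVneq i ord0) => [->|i0]; case: (eqVneq j ord0) => [_|j0] //.
  by rewrite enormB.
have -> : i = j; last by rewrite eqxx.
apply/val_inj; move: i0 j0 (ltn_ord i) (ltn_ord j); rewrite -!val_eqE /=.
by case: (nat_of_ord i) => [|[|?]] //; case: (nat_of_ord j) => [|[|?]].
Qed.

(** For [s < delta], Bob chooses [be] so small that his number of answers, a
    multiple of [be `^ (- delta)], exceeds [(al * be) `^ (- s)]. *)
Lemma local_dim_full : ahlfors_regular_support K -> hausdorff_dim T = hausdorff_dim (K `&` U).
Proof.
move=> [mu [[_ [delta [k1 [k2 [rho0 [k10 k20 rho00 reg]]]]]] muK]].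
have regK x rho : K x -> 0 < rho -> rho < rho0 ->
  ((k1 * rho `^ delta)%:E <= mu (eball x rho))%E /\
  (mu (eball x rho) <= (k2 * rho `^ delta)%:E)%E.
  by rewrite -muK; exact: reg.
have upper s : 0 <= s -> delta < s -> (hausdorff_dim (K `&` U) <= s%:E)%E.
  move=> s0 ds; apply: le_trans (ahlfors_dim_le k10 k20 rho00 regK s0 ds).
  by apply: hausdorff_dim_mono => x [].
apply/eqP; rewrite eq_le hausdorff_dim_mono //=.
have [de0|de0] := leP delta 0.
  apply: le_trans (hausdorff_dim_ge0 _); apply/lee_addgt0Pr => e e0; rewrite add0e.
  by apply: upper; [exact: ltW|exact: le_lt_trans e0].
apply: (@le_trans _ _ delta%:E).
  apply/lee_addgt0Pr => e e0; rewrite -EFinD; apply: upper; last by rewrite ltrDl.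
  by rewrite addr_ge0 // ltW.
apply/lee_subgt0Pr => e e0; rewrite -EFinB.
have [s0|s0] := leP (delta - e) 0.
  by apply: le_trans (hausdorff_dim_ge0 _); rewrite lee_fin.
set s := delta - e in s0 *; have sd : 0 < delta - s by rewrite /s; lra.
pose ka := k1 / (k2 * 6 `^ delta).
have ka0 : 0 < ka by rewrite divr_gt0 // mulr_gt0 // powR_gt0.
have as0 : 0 < al `^ s by rewrite powR_gt0.
have kas : 0 < ka * al `^ s / 2 by rewrite divr_gt0 // mulr_gt0.
pose be := Num.min (1 / 2)
  (Num.min ((ka / 2) `^ delta^-1) ((ka * al `^ s / 2) `^ (delta - s)^-1)).
have be0 : 0 < be by rewrite !lt_min divr_gt0 //= !powR_gt0 // divr_gt0.
have be2 : be <= 1 / 2 by rewrite ge_min lexx.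
have bed : be `^ delta <= ka / 2.
  apply: powR_inv_exponent; [by []|exact: divr_gt0|exact: ltW|].
  by rewrite /be !ge_min lexx orbT.
have bes : be `^ (delta - s) <= ka * al `^ s / 2.
  apply: powR_inv_exponent => //; first exact: ltW.
  by rewrite /be !ge_min lexx !orbT.
have bd0 : 0 < be `^ delta by rewrite powR_gt0.
pose t := ka * be `^ (- delta).
have t2 : 2 <= t by rewrite /t powRN ler_pdivlMr //; lra.
have t0 : 0 <= t by lra.
have /andP[Nt tN] := truncn_itv t0; set N := Num.truncn t in Nt tN.
have N1 : (1 < N)%N by rewrite -(ltr_nat R); move: tN; rewrite -natr1; lra.
have half : t / 2 <= N%:R by move: tN; rewrite -natr1; lra.
apply: (@local_dim_ge (rho0 / 2) be s N) => //.
- by rewrite divr_gt0.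
- by lra.
- apply: (@le_trans _ _ (t / 2 * (al * be) `^ s)); last by rewrite ler_wpM2r // powR_ge0.
  rewrite powRM ?(ltW al0) ?(ltW be0) // /t powRN.
  have bE : be `^ delta = be `^ s * be `^ (delta - s).
    rewrite -powRD; first by rewrite addrC subrK.
    by apply/implyP => _; rewrite gt_eqF.
  have b1 : 0 < be `^ s by rewrite powR_gt0.
  have b2 : 0 < be `^ (delta - s) by rewrite powR_gt0.
  have -> : ka / be `^ delta / 2 * (al `^ s * be `^ s) = ka * al `^ s / 2 / be `^ (delta - s).
    by rewrite bE; field; rewrite !gt_eqF.
  by rewrite ler_pdivlMr // mul1r.
- exact: (ahlfors_branch muK k20 regK de0 be0 be2 Nt).
Qed.

End LocalDimension.

(* Preimages by [f i] are contained in the domain [U].  If [K] is contained in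
   [U], the intersection itself is winning on [K].  In general Bob may start
   away from [U], and the intersection is winning on [K] up to adding the part
   of [K] outside [U] (equivalently, when Bob starts inside [U]). *)
Theorem corollary1p2 (R : realType) (M N : nat) (hM : (1 <= M)%N) (hN : (1 <= N)%N)
    (A : 'M[R]_(M, N)) (K : set 'cV[R]_M) (hK : hyperplane_diffuse K) :
  (forall (U : set 'cV[R]_M) (f : nat -> 'cV[R]_M -> 'cV[R]_M),
     open U -> U `&` K !=set0 -> (forall i, C1_diffeo_on U (f i)) ->
     [/\ winning_on K (preimages_on K U (Bad A) f `|` (K `\` U)),
         K `<=` U -> winning_on K (preimages_on K U (Bad A) f),
         (0 < hausdorff_dim (preimages_on K U (Bad A) f))%E &
         ahlfors_regular_support K ->
           hausdorff_dim (preimages_on K U (Bad A) f) = hausdorff_dim (K `&` U)]) /\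
  (ahlfors_regular_support K -> strongly_C1_incompressible_on K (Bad A)).
Proof.
have [al [al0 al1 win]] := preimages_winning hM hN A hK.
have sub U f : preimages_on K U (Bad A) f `<=` K `&` U.
  by move=> x [Kx /(_ 0%N I)[Ux _]].
have full U f : open U -> U `&` K !=set0 -> (forall i, C1_diffeo_on U (f i)) ->
    ahlfors_regular_support K ->
    hausdorff_dim (preimages_on K U (Bad A) f) = hausdorff_dim (K `&` U).
  by move=> oU UK fC1; exact: (local_dim_full oU UK al0 al1 (sub U f) (win U f oU fC1)).
split; last by move=> hA U f oU UK fC1; exact: full.
move=> U f oU UK fC1; have w := win U f oU fC1; split.
- by exists al.
- move=> KU; exists al; split=> //.
  by move: w; rewrite (_ : K `\` U = set0) ?setU0 // setD_eq0.
- exact: (local_dim_gt0 oU UK al0 al1 w hM hK).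
- exact: full.
Qed.
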